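(* If $S$ is a numerical semigroup with conductor $c$ and embedding dimension $e$, and $|S\cap[0,c)|=13$, then $c\le 13e$.
   Context: A numerical semigroup is a cofinite additive submonoid $S$ of $\mathbb N=\{0,1,2,\ldots\}$ (so $0\in S$, $S+S\subseteq S$, and $\mathbb N\setminus S$ is finite). Its conductor $c$ is the least integer $c\ge 0$ with $c+\mathbb N\subseteq S$. A positive element of $S$ is primitive if it is not a sum of two positive elements of $S$. The embedding dimension $e$ is the number of all primitive elements of $S$ (including those that are at least $c$). *)

(* Defs.v *)
From mathcomp Require Import all_boot.
From mathcomp Require Import classical_sets cardinality.

Set Implicit Arguments.
Unset Strict Implicit.
Unset Printing Implicit Defensive.

Local Open Scope classical_set_scope.
Local Open Scope card_scope.

Definition numerical_semigroup (S : set nat) : Prop :=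
  [/\ S 0, (forall a b, S a -> S b -> S (a + b)) & finite_set (~` S)].

Definition is_conductor (S : set nat) (c : nat) : Prop :=
  (forall n, S (c + n)) /\ (forall d, (forall n, S (d + n)) -> c <= d).

Definition primitive (S : set nat) : set nat :=
  [set x | [/\ 0 < x, S x &
    ~ exists a b, [/\ 0 < a, 0 < b, S a, S b & x = a + b]]].

(* `A #= `I_n` (equipotence with {0, ..., n-1}) says that A has exactly n
   elements; in particular A is finite. *)
Definition has_embdim (S : set nat) (e : nat) : Prop :=
  primitive S #= `I_e.

(* Main.v *)
(* Let m be the multiplicity of S and q the ceiling of c/m. Give every Apery
   element x < c with respect to m the weight w(x) = ceiling of (c - x)/m, the
   number of elements of S in [x, c) congruent to x; then q plus the weights of
   the nonzero Apery elements below c is |L| = 13. By Hermite's identity c is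
   the sum over z in [c, c + m) of the costs, the cost of z being the ceiling of
   (2c - z)/m, and the cost of x + y is at most w(x) + w(y). A decomposable
   Apery z in [c, c + m) lowers the embedding dimension by one. If no Apery
   element below c is decomposable, such z are represented by distinct pairs
   among p primitive elements, and all pairs together weigh (p + 1) times the
   sum of the weights: this is exactly the budget needed. Otherwise every
   decomposable Apery element t < c costs 13 more, but frees the pair
   representing it and contributes (p + 1) w(t); the overspending comes only
   from the z that are sums of three or more primitive elements, all of whose
   partial sums are again among the few t. As the weights add up to 13 - q only,
   few configurations are possible, and the budget holds in all of them but two
   families, in which it is short by one: q = 7 with one primitive element
   besides m, and q = 4 with two primitive elements of weight 3 besides m. There
   the inequality, or the impossibility, follows from m <= 4 or m <= 10. *)
Require Import Defs.
From mathcomp Require Import all_boot.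
From mathcomp Require Import classical_sets cardinality.
From mathcomp Require Import boolp finmap zify.

Set Implicit Arguments.
Unset Strict Implicit.
Unset Printing Implicit Defensive.

(** * Ceilings and sums over pairs *)

Definition ceil (m v : nat) : nat := (v + m.-1) %/ m.

Lemma ceilP m v : 0 < m -> v <= ceil m v * m < v + m.
Proof.
move=> m_gt0; rewrite /ceil.
have e := divn_eq (v + m.-1) m; have l := ltn_pmod (v + m.-1) m_gt0.
by move: e l; set a := _ %/ _ * m; set b := _ %% _ => e l; lia.
Qed.

Lemma ceil_le m v k : 0 < m -> v <= k * m -> ceil m v <= k.
Proof.
move=> m_gt0 le_vk; have /andP[_ lt_v] := ceilP v m_gt0.
by rewrite -ltnS -(ltn_pmul2r m_gt0) mulSn; lia.
Qed.

Lemma ceil_gt m v k : 0 < m -> k * m < v -> k < ceil m v.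
Proof.
move=> m_gt0 lt_kv; have /andP[le_v _] := ceilP v m_gt0.
by rewrite -(ltn_pmul2r m_gt0); lia.
Qed.

Lemma leq_ceil m u v : 0 < m -> u <= v -> ceil m u <= ceil m v.
Proof.
move=> m_gt0 le_uv; apply: ceil_le => //.
by have /andP[le_v _] := ceilP v m_gt0; lia.
Qed.

Lemma ceilD_le m u v : 0 < m -> ceil m (u + v) <= ceil m u + ceil m v.
Proof.
move=> m_gt0; apply: ceil_le => //; rewrite mulnDl.
by have /andP[? _] := ceilP u m_gt0; have /andP[? _] := ceilP v m_gt0; lia.
Qed.

Lemma ceilD_ge m u v : 0 < m -> ceil m u + ceil m v <= ceil m (u + v) + 1.
Proof.
move=> m_gt0; rewrite addn1 -ltnS -(ltn_pmul2r m_gt0) mulnDl !mulSn.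
have /andP[_ ?] := ceilP u m_gt0; have /andP[_ ?] := ceilP v m_gt0.
by have /andP[? _] := ceilP (u + v) m_gt0; lia.
Qed.

Lemma ceilDm m v : 0 < m -> ceil m (v + m) = (ceil m v).+1.
Proof. by move=> m_gt0; rewrite /ceil addnAC divnDr // divnn m_gt0 addn1. Qed.

Lemma ceil0 m : ceil m 0 = 0.
Proof. by rewrite /ceil add0n; case: m => // m; rewrite divn_small. Qed.

(* Hermite's identity. *)
Lemma sum_ceil m c : 0 < m <= c.+1 -> \sum_(i < m) ceil m (c - i) = c.
Proof.
case: m => // m /= le_mc; rewrite /ceil /=.
(* The floor form, by induction on [k]: the shift drops the term [k %/ m.+1] and adds
   [(k + m.+1) %/ m.+1], which is one more. *)
have herm k : \sum_(i < m.+1) (k + i) %/ m.+1 = k.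
  elim: k => [|k IH].
    by apply: big1 => i _; rewrite add0n divn_small.
  rewrite big_ord_recr /= -[in RHS]IH big_ord_recl /= addn0.
  rewrite addSnnS divnDr // divnn /= addn1 addnS addnC; congr (_.+1).
  by congr (_ + _); apply: eq_bigr => i _; rewrite /bump /= add1n addSnnS.
rewrite -[RHS]herm (reindex_inj rev_ord_inj) /=.
apply: eq_bigr => i _; congr (_ %/ _).
by have := ltn_ord i; lia.
Qed.

Lemma leq_sum_sub (I : eqType) (s l : seq I) (f : I -> nat) :
  uniq s -> {subset s <= l} -> \sum_(x <- s) f x <= \sum_(x <- l) f x.
Proof.
elim: s l => [|x s IH] l /=; first by rewrite big_nil.
case/andP=> xs us sl; have xl : x \in l by apply: sl; rewrite inE eqxx.
rewrite big_cons (perm_big _ (perm_to_rem xl)) /= big_cons leq_add2l.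
apply: IH => // y ys; have := sl y; rewrite inE ys orbT => /(_ isT) yl.
have /perm_mem/(_ y) := perm_to_rem xl; rewrite yl inE.
by case: eqP => [eyx|_ //]; rewrite -eyx ys in xs.
Qed.

(** Unordered pairs, equal components allowed; each is listed in one order only. *)
Fixpoint pairs (s : seq nat) : seq (nat * nat) :=
  if s is x :: s' then [seq (x, y) | y <- s] ++ pairs s' else [::].

Lemma mem_pairs s x y : (x, y) \in pairs s -> x \in s /\ y \in s.
Proof.
elim: s => //= z s IH; rewrite inE mem_cat => /predU1P[[-> ->]|].
  by rewrite inE eqxx.
case/orP=> [/mapP[u us [-> ->]]|/IH[xs ys]].
  by rewrite !inE eqxx us orbT.
by rewrite !inE xs ys !orbT.
Qed.

Lemma pairs_mem s x y : x \in s -> y \in s ->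
  ((x, y) \in pairs s) || ((y, x) \in pairs s).
Proof.
elim: s => //= z s IH; rewrite !inE.
case/predU1P=> [->|xs]; case/predU1P=> [->|ys].
- by rewrite eqxx.
- by rewrite !mem_cat map_f ?orbT.
- by rewrite !mem_cat (map_f (pair z) xs) ?orbT.
- by rewrite !mem_cat; case/orP: (IH xs ys) => ->; rewrite ?orbT.
Qed.

(** An entry fills one place in its pair with each other entry and both places in the pair with
    itself. *)
Lemma sum_pairs s (f : nat -> nat) :
  \sum_(p <- pairs s) (f p.1 + f p.2) = (size s).+1 * \sum_(x <- s) f x.
Proof.
elim: s => [|x s IH]; first by rewrite !big_nil.
rewrite /= !big_cons big_cat big_map IH /= big_split /=.
rewrite [X in _ + (X + _ + _)]big_const_seq count_predT iter_addn_0.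
by set S := \sum_(y <- s) _; nia.
Qed.

Lemma iota0E c : iota 0 c = index_iota 0 c.
Proof. by rewrite /index_iota subn0. Qed.

Lemma leq_sum_size (I : eqType) (s r : seq I) (f : I -> nat) :
  uniq s -> uniq r -> {subset s <= r} -> (forall x, x \in r -> 0 < f x) ->
  \sum_(x <- s) f x + size r <= \sum_(x <- r) f x + size s.
Proof.
move=> us ur sr f_gt0; have e : perm_eq r (s ++ [seq x <- r | x \notin s]).
  apply: uniq_perm => //.
    rewrite cat_uniq us (filter_uniq _ ur) /= andbT.
    by apply/hasPn => x; rewrite mem_filter => /andP[].
  move=> x; rewrite mem_cat mem_filter; case xs: (x \in s) => //=.
  exact: sr.
rewrite (perm_big _ e) (perm_size e) big_cat size_cat /=.
rewrite -addnA leq_add2l addnC leq_add2r.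
rewrite -sum1_size big_seq [X in _ <= X]big_seq; apply: leq_sum => x.
by rewrite mem_filter => /andP[_ /f_gt0].
Qed.

Lemma sum_bool (I : Type) (r : seq I) (P b : pred I) :
  \sum_(x <- r | P x) (b x : nat) = size [seq x <- r | P x && b x].
Proof.
rewrite size_filter -sum1_count big_mkcondr.
by apply: eq_bigr => x _; case: (b x).
Qed.

(** * Sums of two or three elements of a short list *)

Lemma mem_cubics2 (a b x y d : nat) : x = a \/ x = b -> y = a \/ y = b ->
  d = a \/ d = b ->
  x + y + d \in [:: a + (a + a); a + (a + b); b + (a + b); b + (b + b)].
Proof.
have E0 : a + b + a = a + (a + b) by lia.
have E1 : b + a + a = a + (a + b) by lia.
have E2 : b + a + b = b + (a + b) by lia.
have E3 : a + b + b = b + (a + b) by lia.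
have E4 : b + b + a = b + (a + b) by lia.
case=> -> [] -> [] ->; rewrite !inE ?E0 ?E1 ?E2 ?E3 ?E4 -?addnA ?eqxx ?orbT //.
Qed.

(** Here and in the next lemma, sizes become sums of membership bits over an explicit list, ready
    for case analysis. *)
Lemma size_count_mem (T : eqType) (s l : seq T) : uniq s -> {subset s <= l} ->
  size s <= count (mem s) l.
Proof.
move=> us sl; rewrite -size_filter; apply: uniq_leq_size us _ => x xs.
by rewrite mem_filter /= xs sl.
Qed.

Lemma size_count_uniq (T : eqType) (s l : seq T) : uniq s -> uniq l ->
  {subset s <= l} -> size s = count (mem s) l.
Proof.
move=> us ul sl; rewrite -size_filter; apply/perm_size/uniq_perm => //.
  exact: filter_uniq.
by move=> x; rewrite mem_filter /=; case xs: (x \in s); rewrite // sl.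
Qed.

Ltac mem_lia := 
  repeat match goal with
  | |- is_true (_ || _) =>
      first [by apply/orP; left; apply/eqP; lia | apply/orP; right]
  end; apply/eqP; lia.

Lemma mem_quadrics3 (x y z a b : nat) : a \in [:: x; y; z] -> b \in [:: x; y; z] ->
  a + b \in [:: x + x; x + y; x + z; y + y; y + z; z + z].
Proof.
rewrite !in_cons !in_nil !orbF.
by move=> /or3P[]/eqP-> /or3P[]/eqP->; clear; mem_lia.
Qed.

Lemma mem_cubics3 (x y z a b d : nat) : a \in [:: x; y; z] -> b \in [:: x; y; z] ->
  d \in [:: x; y; z] ->
  a + b + d \in [:: x + x + x; x + x + y; x + x + z; x + y + y; x + y + z;
                    x + z + z; y + y + y; y + y + z; y + z + z; z + z + z].
Proof.
rewrite !in_cons !in_nil !orbF.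
by move=> /or3P[]/eqP-> /or3P[]/eqP-> /or3P[]/eqP->; clear; mem_lia.
Qed.

(* Each cubic in [P] forces its quadratic factors into [T]; the only possible
   coincidence among the six quadratics is [x + z = y + y]. *)
Lemma cubic_count (x y z : nat) (T P : seq nat) : x < y < z ->
  uniq T -> uniq P ->
  (forall t, t \in T -> exists a b, [/\ a \in [:: x; y; z], b \in [:: x; y; z]
     & t = a + b]) ->
  (forall p, p \in P -> exists a b d, [/\ a \in [:: x; y; z],
     b \in [:: x; y; z], d \in [:: x; y; z] & p = a + b + d]) ->
  (forall a b d, a \in [:: x; y; z] -> b \in [:: x; y; z] ->
     d \in [:: x; y; z] -> a + b + d \in P ->
     [/\ a + b \in T, a + d \in T & b + d \in T]) ->
  (size T = 3 -> size P <= 4) /\ (size T = 4 -> size P <= 6).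
Proof.
move=> /andP[xy yz] uT uP Tsum Psum PT.
have X : x \in [:: x; y; z] by rewrite inE eqxx.
have Y : y \in [:: x; y; z] by rewrite !inE eqxx orbT.
have Z : z \in [:: x; y; z] by rewrite !inE eqxx !orbT.
have le3 a b d : a \in [:: x; y; z] -> b \in [:: x; y; z] ->
    d \in [:: x; y; z] ->
    [/\ (a + b + d \in P) <= (a + b \in T),
        (a + b + d \in P) <= (a + d \in T) &
        (a + b + d \in P) <= (b + d \in T)].
  move=> aX bX dX; case e: (_ \in P) => //.
  by have [-> -> ->] := PT a b d aX bX dX e.
have [q1 _ _] := le3 x x x X X X; have [q2 q3 _] := le3 x x y X X Y.
have [q4 q5 _] := le3 x x z X X Z; have [q6 _ q7] := le3 x y y X Y Y.
have [q8 q9 q10] := le3 x y z X Y Z; have [q11 _ q12] := le3 x z z X Z Z.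
have [q13 _ _] := le3 y y y Y Y Y; have [q14 q15 _] := le3 y y z Y Y Z.
have [q16 _ q17] := le3 y z z Y Z Z; have [q18 _ _] := le3 z z z Z Z Z.
have [e|ne] := eqVneq (x + z) (y + y).
(* In an arithmetic progression the ten cubics shrink to seven and the six quadratics to five. *)
- have [ex ez ey] : [/\ x + x + z = x + y + y, x + z + z = y + y + z &
      x + y + z = y + y + y] by move: e; clear; split; lia.
  have sT : {subset T <= [:: x + x; x + y; y + y; y + z; z + z]}.
    move=> t /Tsum[a [b [aX bX ->]]]; have := mem_quadrics3 aX bX.
    by rewrite e !inE; do 5!case: (_ == _).
  have uV : uniq [:: x + x; x + y; y + y; y + z; z + z].
    by rewrite /= !inE !negb_or; move: xy yz; clear => ? ?;
       repeat (apply/andP; split); apply/eqP; lia.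
  have sP : {subset P <= [:: x + x + x; x + x + y; x + y + y; y + y + y;
      y + y + z; y + z + z; z + z + z]}.
    move=> t /Psum[a [b [d [aX bX dX ->]]]]; have := mem_cubics3 aX bX dX.
    by rewrite ex ez ey !inE; do 7!case: (_ == _).
  have := size_count_uniq uT uV sT; have := size_count_mem uP sP.
  rewrite /= !addn0 => hP ->.
  rewrite ex ez ey e in q4 q5 q8 q9 q10 q11 q12.
  (* Of the cubic bits only their bounds by quadratic bits are kept, so the case analysis runs over
     the quadratics alone. *)
  split=> sz; apply: leq_trans hP _; move: sz;
  move: q1 q2 q3 q4 q5 q6 q7 q8 q9 q10 q11 q12 q13 q14 q15 q16 q17 q18;
  clear; repeat match goal with |- context [nat_of_bool (?u \in P)] =>
    move: (nat_of_bool (u \in P)) end;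
  by do 5![case: (_ \in T)] => /=; lia.
- have sT : {subset T <= [:: x + x; x + y; x + z; y + y; y + z; z + z]}.
    by move=> t /Tsum[a [b [aX bX ->]]]; apply: mem_quadrics3.
  have uV : uniq [:: x + x; x + y; x + z; y + y; y + z; z + z].
    rewrite /= !inE !negb_or ne; move: xy yz; clear => ? ?.
    by repeat (apply/andP; split) => //; apply/eqP; lia.
  have sP : {subset P <= [:: x + x + x; x + x + y; x + x + z; x + y + y;
      x + y + z; x + z + z; y + y + y; y + y + z; y + z + z; z + z + z]}.
    by move=> t /Psum[a [b [d [aX bX dX ->]]]]; apply: mem_cubics3.
  have := size_count_uniq uT uV sT; have := size_count_mem uP sP.
  rewrite /= !addn0; move=> hP ->; split=> sz; apply: leq_trans hP _; move: sz;
  move: q1 q2 q3 q4 q5 q6 q7 q8 q9 q10 q11 q12 q13 q14 q15 q16 q17 q18;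
  clear; repeat match goal with |- context [nat_of_bool (?u \in P)] =>
    move: (nat_of_bool (u \in P)) end;
  by do 6![case: (_ \in T)] => /=; lia.
Qed.

(** Keeps the arithmetic hypotheses only; disjunctions are dropped too and must be split
    beforehand. *)
Ltac keep_nat :=
  repeat match goal with
  | H : ?T |- _ =>
    lazymatch T with
    | is_true (leq _ _) => fail
    | is_true (_ && _) => fail
    | is_true (~~ (leq _ _)) => fail
    | @eq ?U _ _ => tryif unify U nat then fail else clear H
    | ~ @eq ?U _ _ => tryif unify U nat then fail else clear H
    | _ => clear H
    end
  end.

Ltac nlia := keep_nat; lia.

Ltac split12 e := let E := fresh in
  have [E|E] : e = 1 \/ e = 2 by lia.

(** * Weights and costs *)

Section LeftPart.

Variables (S : pred nat) (m c : nat).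

Definition dec (z : nat) : bool :=
  has (fun a => [&& 0 < a, S a, a < z & S (z - a)]) (iota 0 z).

Lemma decP z :
  reflect (exists a b, [/\ 0 < a, 0 < b, S a, S b & z = a + b]) (dec z).
Proof.
apply: (iffP hasP) => [[a _ /and4P[a0 Sa az Sza]]|[a [b [a0 b0 Sa Sb ->]]]].
  by exists a, (z - a); split=> //; lia.
exists a; first by rewrite mem_iota; lia.
by rewrite a0 Sa addKn Sb -{1}(addn0 a) ltn_add2l b0.
Qed.

Definition left_part : seq nat := [seq x <- iota 0 c | S x].

(* Truncated subtraction makes [S (x - m)] true for [x <= m], so [0] and [m]
   are excluded. *)
Definition apery : seq nat := [seq x <- iota 0 c | S x && ~~ S (x - m)].

Definition aprim : seq nat := [seq x <- apery | ~~ dec x].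

Definition adec : seq nat := [seq x <- apery | dec x].

(* The decomposable Apery elements in the window [c, c + m). *)
Definition wdec : seq nat := [seq z <- iota c m | ~~ S (z - m) && dec z].

(** The bound loses nothing: from [c + m] on, [m] can be split off. *)
Definition prims : seq nat :=
  [seq x <- iota 0 (c + m) | [&& S x, 0 < x & ~~ dec x]].

Definition wt (x : nat) : nat := ceil m (c - x).

Definition depth : nat := ceil m c.

Definition cost (z : nat) : nat := ceil m (2 * c - z).

Definition psum (z : nat) : bool := has (fun p => p.1 + p.2 == z) (pairs aprim).

(** The default [(0, 0)] is returned only when [psum z] fails. *)
Definition rep (z : nat) : nat * nat :=
  nth (0, 0) (pairs aprim) (find (fun p => p.1 + p.2 == z) (pairs aprim)).

Definition rwt (z : nat) : nat := wt (rep z).1 + wt (rep z).2.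

Definition adec2 : seq nat := [seq x <- adec | psum x].
(* The elements of [adec3] and [wdec2] are sums of three or more, but not of two,
   primitive Apery elements. *)
Definition adec3 : seq nat := [seq x <- adec | ~~ psum x].
Definition wdec1 : seq nat := [seq x <- wdec | psum x].
Definition wdec2 : seq nat := [seq x <- wdec | ~~ psum x].

Hypothesis S0 : S 0.
Hypothesis SD : forall a b, S a -> S b -> S (a + b).
Hypothesis m_gt0 : 0 < m.
Hypothesis Sm : S m.
Hypothesis m_min : forall x, 0 < x -> S x -> m <= x.
Hypothesis Sc : forall x, c <= x -> S x.
Hypothesis lt_mc : m < c.

(** * Apery elements and the counts they determine *)

Lemma mem_apery x : (x \in apery) = [&& x < c, S x & ~~ S (x - m)].
Proof. by rewrite mem_filter mem_iota add0n andbC. Qed.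

Lemma apery_uniq : uniq apery.
Proof. by rewrite filter_uniq // iota_uniq. Qed.

Lemma mem_aprim x : (x \in aprim) = (x \in apery) && ~~ dec x.
Proof. by rewrite mem_filter andbC. Qed.

Lemma mem_adec x : (x \in adec) = (x \in apery) && dec x.
Proof. by rewrite mem_filter andbC. Qed.

Lemma mem_wdec z :
  (z \in wdec) = [&& c <= z < c + m, ~~ S (z - m) & dec z].
Proof. by rewrite mem_filter mem_iota andbC. Qed.

Lemma apery_gt x : x \in apery -> m < x < c.
Proof.
rewrite mem_apery => /and3P[xc Sx nS]; rewrite xc andbT ltnNge.
by apply: contra nS => le_xm; have -> : x - m = 0 by lia.
Qed.

Lemma aprim_sub x : x \in aprim -> x \in apery.
Proof. by rewrite mem_aprim => /andP[]. Qed.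

Lemma adec_sub x : x \in adec -> x \in apery.
Proof. by rewrite mem_adec => /andP[]. Qed.

Lemma apery_S x : x \in apery -> S x.
Proof. by rewrite mem_apery => /and3P[]. Qed.

Lemma apery_prim_or_dec x : x \in apery -> (x \in aprim) || (x \in adec).
Proof. by move=> xA; rewrite mem_aprim mem_adec xA; case: dec. Qed.

Lemma aprim_adec x : x \in aprim -> x \in adec -> False.
Proof. by rewrite mem_aprim mem_adec => /andP[_ /negP nd] /andP[_ /nd]. Qed.

(** An element of [S] below [c] outside [apery] is 0 or at least [m], by minimality of [m]. *)
Lemma sum_left (f : nat -> nat) :
  \sum_(x <- left_part) f x =
  \sum_(x <- apery) f x + f 0 + \sum_(m <= y < c | S (y - m)) f y.
Proof.
rewrite !big_filter (bigID (fun x => S (x - m))) /= addnC -addnA; congr addn.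
rewrite iota0E.
rewrite (@big_cat_nat _ _ _ m) ?(ltnW lt_mc) //=; congr addn.
  rewrite big_mkcond big_ltn //= ?sub0n !S0 /=.
  rewrite big1_seq ?addn0 // => x /=; rewrite mem_index_iota => /andP[x0 xm].
  by case Sx: (S x); rewrite //= leqNgt ltnS in xm *; have := m_min x0 Sx; lia.
rewrite big_nat_cond [RHS]big_nat_cond; apply: eq_bigl => y.
case: (leqP m y) => //= le_my; case: (y < c) => //=.
case Sy: (S (y - m)); rewrite ?andbF // andbT.
by rewrite -(subnK le_my) SD.
Qed.

Lemma wt_step x : x < c -> wt x = (wt (x + m)).+1.
Proof.
move=> xc; rewrite /wt; case: (leqP m (c - x)) => [le_m|lt_m].
  by rewrite -ceilDm // subnDA subnK.
rewrite subnDA (_ : c - x - m = 0); last by lia.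
rewrite ceil0; apply/eqP; rewrite eqn_leq ceil_le //; last by lia.
by rewrite ceil_gt // mul0n; lia.
Qed.

Lemma sum_shift (f : nat -> nat) :
  \sum_(m <= y < c | S (y - m)) f y = \sum_(0 <= x < c - m | S x) f (x + m).
Proof.
rewrite -{1}(add0n m) big_addn.
by apply: eq_bigl => x; rewrite addnK.
Qed.

(** Telescoping: a shift by [m] lowers [wt] by one on [left_part], and the shifted elements cancel
    in [sum_left], leaving [apery] and [wt 0], which is [depth]. *)
Lemma size_left : size left_part = depth + \sum_(x <- apery) wt x.
Proof.
have e1 : \sum_(x <- left_part) wt x =
    \sum_(x <- left_part) wt (x + m) + size left_part.
  rewrite -sum1_size -big_split /=; apply: eq_big_seq => x.
  by rewrite mem_filter mem_iota addn1 => /andP[_ /andP[_ xc]]; rewrite wt_step.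
have e2 : \sum_(x <- left_part) wt (x + m) =
    \sum_(m <= y < c | S (y - m)) wt y.
  rewrite sum_shift big_filter iota0E.
  rewrite (@big_cat_nat _ _ _ (c - m)) ?leq_subr //= [X in _ + X]big1_seq ?addn0 //.
  move=> x /andP[_]; rewrite mem_index_iota => /andP[x1 x2].
  by rewrite /wt (_ : c - _ = 0) ?ceil0 //; lia.
have := sum_left wt; rewrite e1 e2 /depth -[wt 0]/(ceil m (c - 0)) subn0.
by lia.
Qed.

(** Subtracting [m] gives the elements of [S] in [[c - m, c)], one for each residue class met by
    [left_part]; the extra one is the class of 0. *)
Lemma size_window :
  \sum_(c <= z < c + m | S (z - m)) 1 = (size apery).+1.
Proof.
have := sum_left (fun=> 1); rewrite !sum1_size sum_shift.
have -> : size left_part = \sum_(0 <= x < c | S x) 1.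
  by rewrite -sum1_size big_filter /index_iota subn0.
rewrite (@big_cat_nat _ _ _ (c - m)) ?leq_subr //= => e.
have -> : \sum_(c <= z < c + m | S (z - m)) 1 = \sum_(c - m <= x < c | S x) 1.
  rewrite -{1}(subnK (ltnW lt_mc)) big_addn addnK.
  by apply: eq_bigl => x; rewrite addnK.
by lia.
Qed.

(** Each of the [m] residue classes has one Apery element, primitive or decomposable; for the class
    of 0 the primitive element [m] is counted instead. *)
Lemma size_prims : size prims + size adec + size wdec = m.
Proof.
rewrite /prims iotaD filter_cat size_cat add0n.
have -> : size [seq x <- iota 0 c | [&& S x, 0 < x & ~~ dec x]] =
    (size aprim).+1.
  have := sum_left (fun x => (0 < x) && ~~ dec x).
  rewrite big_filter /= addn0 [X in _ = _ + X]big_ltn_cond // subnn S0.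
  have -> : (0 < m) && ~~ dec m = true.
    rewrite m_gt0; apply/decP => -[a [b [a0 b0 Sa Sb e]]].
    by have := m_min a0 Sa; lia.
  rewrite [X in _ = _ + (_ + X)]big1_seq ?addn0; last first.
    move=> y /andP[Sy]; rewrite mem_index_iota => /andP[my yc].
    suff -> : dec y by rewrite andbF.
    by apply/decP; exists m, (y - m); split=> //; lia.
  rewrite (eq_big_seq (fun x => nat_of_bool (~~ dec x))); last first.
    by move=> x /apery_gt xm; rewrite (_ : 0 < x) //; lia.
  by rewrite !sum_bool addn1 => ->.
have eA : size aprim + size adec = size apery.
  by rewrite /aprim /adec 2!size_filter addnC count_predC.
have eW : size [seq x <- iota c m | [&& S x, 0 < x & ~~ dec x]] +
    \sum_(c <= z < c + m | S (z - m)) 1 + size wdec = m.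
  rewrite -[RHS](size_iota c) /wdec !size_filter /index_iota addKn sum1_count.
  rewrite -addnA -count_predUI.
  rewrite (eq_count (_ : predI _ _ =1 pred0)) ?count_pred0 ?addn0; last first.
    by move=> z /=; case: S.
  rewrite -(count_predC dec) addnC; congr addn; apply: eq_in_count => z.
    rewrite mem_iota /= => zc; case e: (S (z - m)) => //=.
    by apply/esym/decP; exists m, (z - m); split=> //; lia.
  rewrite mem_iota /= => /andP[zc _]; rewrite (Sc zc).
  by rewrite (leq_trans _ zc) // (leq_trans m_gt0 (ltnW lt_mc)).
move: eW; rewrite size_window -eA.
move: (size aprim) (size adec) (size wdec) (size [seq _ <- _ | _]).
by move=> ? ? ? ?; lia.
Qed.

(** * Estimates for weights and costs *)

Lemma wt_gt0 x : x \in apery -> 0 < wt x.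
Proof. by move/apery_gt => xc; rewrite ceil_gt // mul0n; lia. Qed.

Lemma wt_lt_depth x : x \in apery -> wt x < depth.
Proof.
move=> /apery_gt xc; rewrite /depth -[in X in _ < X](subnK (ltnW lt_mc)).
by rewrite ceilDm // ltnS leq_ceil //; lia.
Qed.

(** This bound and the next come from [c + (c - (x + y)) = (c - x) + (c - y)], where rounding costs
    at most one. *)
Lemma wtD_ge x y : x + y <= c -> depth + wt (x + y) <= wt x + wt y + 1.
Proof.
move=> xyc; apply: leq_trans (ceilD_ge _ _ m_gt0) _; rewrite leq_add2r.
apply: leq_trans (ceilD_le _ _ m_gt0); apply: leq_ceil => //; lia.
Qed.

Lemma wtD_le x y : x + y <= c -> wt x + wt y <= depth + wt (x + y) + 1.
Proof.
move=> xyc; apply: leq_trans (ceilD_ge _ _ m_gt0) _; rewrite leq_add2r.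
apply: leq_trans (ceilD_le _ _ m_gt0); apply: leq_ceil => //; lia.
Qed.

Lemma wtD_lt x y : m <= x -> y < c -> wt (x + y) < wt y.
Proof.
move=> mx yc; rewrite [wt y]wt_step // ltnS /wt.
by apply: leq_ceil => //; lia.
Qed.

Lemma cost_le x y : x <= c -> y <= c -> cost (x + y) <= wt x + wt y.
Proof.
move=> xc yc; apply: leq_trans (ceilD_le _ _ m_gt0).
by apply: leq_ceil => //; lia.
Qed.

(** With [cost_depth], a cost in the window is [depth] or one less. *)
Lemma cost_ge z : z < c + m -> depth <= cost z + 1.
Proof.
move=> zc; rewrite addn1 -ceilDm //; apply: leq_ceil => //; lia.
Qed.

Lemma cost_depth z : c <= z -> cost z <= depth.
Proof. by move=> cz; apply: leq_ceil => //; lia. Qed.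

(** * Decompositions of Apery elements *)

Definition aperyN (z : nat) : bool := (z < c + m) && ~~ S (z - m).

Lemma apery_aperyN z : z \in apery -> aperyN z.
Proof.
by rewrite mem_apery /aperyN => /and3P[zc _ ->]; rewrite andbT; lia.
Qed.

Lemma wdec_aperyN z : z \in wdec -> aperyN z.
Proof. by rewrite mem_wdec /aperyN => /and3P[/andP[_ ->] -> _]. Qed.

(** If [a - m] were in [S], so would be [a + b - m]; and [a] is below [c] because [b] is at least
    [m]. Using [aperyN] covers sums below [c] and in the window alike. *)
Lemma aperyN_split a b : aperyN (a + b) -> 0 < a -> 0 < b -> S a -> S b ->
  (a \in apery) /\ (b \in apery).
Proof.
move=> /andP[zc nS] a0 b0 Sa Sb.
have ma := m_min a0 Sa; have mb := m_min b0 Sb.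
rewrite !mem_apery Sa Sb /=; split; apply/andP; split; first lia.
- by apply: contra nS => Sam; rewrite addnC -addnBA // SD.
- by lia.
- by apply: contra nS => Sbm; rewrite -addnBA // SD.
Qed.

Lemma aperyN_triple a b d : aperyN (a + b + d) ->
  a \in apery -> b \in apery -> d \in apery -> a + b \in adec.
Proof.
move=> zN aA bA dA.
have [a0 b0 d0] : [/\ 0 < a, 0 < b & 0 < d].
  by split; [case/apery_gt/andP: aA | case/apery_gt/andP: bA |
             case/apery_gt/andP: dA] => h _; apply: leq_trans h.
have [Sa Sb Sd] : [/\ S a, S b & S d] by rewrite !apery_S.
have [abA _] : (a + b \in apery) /\ (d \in apery).
  by apply: aperyN_split; rewrite ?SD // addn_gt0 a0.
by rewrite mem_adec abA; apply/decP; exists a, b.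
Qed.

(** A decomposable first summand is split again by induction, and its remainder joins the second
    summand. *)
Lemma dec_split z : aperyN z -> dec z ->
  exists x y, [/\ x \in aprim, y \in apery & z = x + y].
Proof.
elim/ltn_ind: z => z IH zN /decP[a [b [a0 b0 Sa Sb ez]]].
have zN' : aperyN (a + b) by rewrite -ez.
have [aA bA] := aperyN_split zN' a0 b0 Sa Sb.
case/orP: (apery_prim_or_dec aA) => [aP|aD]; first by exists a, b.
have lt_az : a < z by rewrite ez -[X in X < _]addn0 ltn_add2l.
have da : dec a by move: aD; rewrite mem_adec => /andP[].
have [x [y [xP yA ea]]] := IH a lt_az (apery_aperyN aA) da.
have /andP[mx _] := apery_gt (aprim_sub xP).
have x0 : 0 < x := leq_trans m_gt0 (ltnW mx).
exists x, (y + b); split=> //; last by rewrite addnA -ea.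
have := @aperyN_split x (y + b); case.
- by rewrite addnA -ea -ez.
- by [].
- by rewrite addn_gt0 b0 orbT.
- exact/apery_S/aprim_sub.
- by rewrite SD // apery_S.
- by [].
Qed.

Lemma repP z : psum z ->
  [/\ (rep z).1 \in aprim, (rep z).2 \in aprim & (rep z).1 + (rep z).2 = z].
Proof.
move=> hz; have /eqP e := nth_find (0, 0) hz.
have : rep z \in pairs aprim by rewrite mem_nth // -has_find.
by rewrite [rep z]surjective_pairing => /mem_pairs[].
Qed.

Lemma psumI x y : x \in aprim -> y \in aprim -> psum (x + y).
Proof.
move=> xP yP; apply/hasP; case/orP: (pairs_mem xP yP) => h.
  by exists (x, y).
by exists (y, x) => //=; rewrite addnC.
Qed.

(** Different sums have different representing pairs, so this is part of the total over all
    pairs. *)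
Lemma sum_rwt (s : seq nat) : uniq s -> all psum s ->
  \sum_(z <- s) rwt z <= (size aprim).+1 * \sum_(x <- aprim) wt x.
Proof.
move=> us /allP ps; rewrite -sum_pairs.
rewrite -(big_map rep xpredT (fun p => wt p.1 + wt p.2)) /=.
apply: leq_sum_sub => [|_ /mapP[z zs ->]].
  rewrite map_inj_in_uniq // => z1 z2 /ps/repP[_ _ e1] /ps/repP[_ _ e2] e.
  by rewrite -e1 -e2 e.
by rewrite mem_nth // -has_find; apply: ps.
Qed.

Lemma cost_rwt z : psum z -> cost z <= rwt z.
Proof.
move=> /repP[xP yP e]; rewrite -{1}e; apply: cost_le.
  by have := apery_gt (aprim_sub xP); lia.
by have := apery_gt (aprim_sub yP); lia.
Qed.

(** * The budget inequality *)

Lemma adec_uniq : uniq adec. Proof. exact/filter_uniq/apery_uniq. Qed.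
Lemma aprim_uniq : uniq aprim. Proof. exact/filter_uniq/apery_uniq. Qed.
Lemma wdec_uniq : uniq wdec. Proof. exact/filter_uniq/iota_uniq. Qed.

Lemma size_aperyE : size apery = size aprim + size adec.
Proof. by rewrite /aprim /adec 2!size_filter addnC count_predC. Qed.

Lemma sum_aperyE (f : nat -> nat) :
  \sum_(x <- apery) f x = \sum_(x <- aprim) f x + \sum_(x <- adec) f x.
Proof. by rewrite [LHS](bigID dec) /= addnC !big_filter. Qed.

Lemma size_apery_wdec : size apery + size wdec < m.
Proof.
rewrite -addSn -size_window -[X in _ <= X](size_iota c).
rewrite /wdec size_filter sum1_count /index_iota addKn -count_predUI.
rewrite (eq_count (_ : predI _ _ =1 pred0)) ?count_pred0 ?addn0 ?count_size //.
by move=> z /=; case: S.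
Qed.

(** By Hermite's identity the costs over the window sum to [c]; outside [wdec] each is at most
    [depth]. *)
Lemma depth_window :
  c + depth * size wdec <= depth * m + \sum_(z <- wdec) cost z.
Proof.
have e : \sum_(z <- iota c m) cost z = c.
  have le_mc1 : 0 < m <= c.+1 by rewrite m_gt0; lia.
  rewrite -[RHS](sum_ceil le_mc1) -[in iota c m](addn0 c) iotaDl big_map.
  rewrite iota0E big_mkord; apply: eq_bigr => i _; congr ceil.
  by lia.
rewrite -{1}e /wdec; set W := fun z => ~~ S (z - m) && dec z.
rewrite (bigID W) /= big_filter -addnA addnC leq_add2r.
rewrite size_filter -sum1_count big_distrr /= -[in X in _ <= X](size_iota c m).
rewrite -sum1_size big_distrr /= [X in _ <= X](bigID W) /= addnC muln1 leq_add2l.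
rewrite big_seq_cond [X in _ <= X]big_seq_cond; apply: leq_sum => z.
by rewrite mem_iota => /andP[/andP[cz _] _]; apply: cost_depth.
Qed.

(* The pairs of primitive elements weigh [(size aprim).+1 * \sum_(aprim) wt] in
   all; the pairs representing [adec2] are lost for [wdec1]. *)
Lemma wilf_of_budget (l : nat) : size left_part = l ->
  depth * size adec + \sum_(z <- wdec2) cost z <=
  (size aprim).+1 * \sum_(x <- adec) wt x + \sum_(x <- adec2) rwt x ->
  c <= l * size prims.
Proof.
rewrite size_left sum_aperyE => el budget.
have K1 : \sum_(z <- wdec1) cost z <= \sum_(z <- wdec1) rwt z.
  rewrite [X in X <= _]big_seq [X in _ <= X]big_seq; apply: leq_sum => z.
  by rewrite mem_filter => /andP[/cost_rwt].
have U : uniq (adec2 ++ wdec1).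
  rewrite cat_uniq !filter_uniq ?adec_uniq ?wdec_uniq ?iota_uniq //.
  rewrite andbT.
  apply/hasPn => z; rewrite mem_filter mem_wdec => /and3P[_ /andP[cz _] _].
  by apply/negP; rewrite mem_filter => /andP[_ /adec_sub/apery_gt]; lia.
have /(sum_rwt U) : all psum (adec2 ++ wdec1).
  by rewrite all_cat; apply/andP; split; apply/allP => z;
     rewrite mem_filter => /andP[].
rewrite big_cat /= => K2.
have K3 : \sum_(z <- wdec) cost z =
    \sum_(z <- wdec1) cost z + \sum_(z <- wdec2) cost z.
  by rewrite [LHS](bigID psum) /= !big_filter.
have := depth_window; have := size_apery_wdec; have := size_prims.
rewrite size_aperyE -el K3; move: K1 K2 budget {el K3}.
move: (\sum_(z <- wdec1) cost z) (\sum_(z <- wdec2) cost z).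
move: (\sum_(z <- wdec1) rwt z) (\sum_(z <- adec2) rwt z).
move: (\sum_(z <- aprim) wt z) (\sum_(z <- adec) wt z).
move: (size prims) (size wdec) (size aprim) (size adec) depth => e d p t q.
move=> Q wT r1 r2 k1 k2 h1 h2 h3 h4 h5 h6.
(* The bounds add up to [c <= e * q + p.+1 * (Q + wT)], and [p < e] finishes. *)
have e1 : m = e + t + d by lia.
rewrite {}e1 in h4 h5 h6.
by nia.
Qed.

(** * The case |L| = 13 *)

Hypothesis size13 : size left_part = 13.

Lemma weight13 :
  depth + \sum_(x <- aprim) wt x + \sum_(x <- adec) wt x = 13.
Proof. by rewrite -size13 size_left sum_aperyE addnA. Qed.

Lemma adec_wt x y : x \in apery -> y \in apery -> x + y \in adec ->
  [/\ depth + wt (x + y) <= wt x + wt y + 1,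
      wt x + wt y <= depth + wt (x + y) + 1,
      wt (x + y) < wt x, wt (x + y) < wt y & 0 < wt (x + y)].
Proof.
move=> /apery_gt/andP[mx xc] /apery_gt/andP[my yc] /adec_sub xyA.
have /andP[_ xyc] := apery_gt xyA.
split; [exact: wtD_ge (ltnW xyc) | exact: wtD_le (ltnW xyc) | | | exact: wt_gt0].
  by rewrite addnC wtD_lt // ltnW.
by rewrite wtD_lt // ltnW.
Qed.

Lemma wdec_cost x y : x \in apery -> y \in apery -> x + y \in wdec ->
  [/\ cost (x + y) <= wt x + wt y, depth <= cost (x + y) + 1 &
      cost (x + y) <= depth].
Proof.
move=> /apery_gt/andP[_ xc] /apery_gt/andP[_ yc].
rewrite mem_wdec => /and3P[/andP[cz zc] _ _].
by split; [exact: cost_le (ltnW xc) (ltnW yc) | exact: cost_ge | exact: cost_depth].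
Qed.

Lemma wdec2_sub z : z \in wdec2 -> z \in wdec.
Proof. by rewrite mem_filter => /andP[]. Qed.

Lemma wdec2_uniq : uniq wdec2. Proof. exact/filter_uniq/wdec_uniq. Qed.

Lemma wdec2_ge z : z \in wdec2 -> c <= z.
Proof. by move/wdec2_sub; rewrite mem_wdec => /and3P[/andP[]]. Qed.

Lemma wdec2_lt z : z \in wdec2 -> z < c + m.
Proof. by move/wdec2_sub; rewrite mem_wdec => /and3P[/andP[]]. Qed.

Lemma wdec2_le z : z \in wdec2 -> cost z <= depth.
Proof. by move/wdec2_ge/cost_depth. Qed.

Lemma sum_wdec2 (l : seq nat) : {subset wdec2 <= l} ->
  \sum_(z <- wdec2) cost z <= \sum_(z <- l) (z \in wdec2) * cost z.
Proof.
move=> sl; rewrite big_seq.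
rewrite (eq_bigr (fun z => (z \in wdec2) * cost z)); last first.
  by move=> z ->; rewrite mul1n.
by rewrite -big_seq; apply: leq_sum_sub sl; apply: wdec2_uniq.
Qed.

(** Were the second summand primitive too, [psum z] would hold. *)
Lemma wdec2_split z : z \in wdec2 ->
  exists y t, [/\ y \in aprim, t \in adec & z = y + t].
Proof.
rewrite mem_filter => /andP[np zW].
have [] := dec_split (wdec_aperyN zW).
  by move: zW; rewrite mem_wdec => /and3P[].
move=> y [t [yP tA ez]]; exists y, t; split=> //.
case/orP: (apery_prim_or_dec tA) => // tP.
by move: np; rewrite ez psumI.
Qed.

Lemma wdec2_triple a b d : a + b + d \in wdec2 ->
  a \in apery -> b \in apery -> d \in apery ->
  [/\ a + b \in adec, a + d \in adec & b + d \in adec].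
Proof.
move=> /wdec2_sub/wdec_aperyN zN aA bA dA; split.
- exact: aperyN_triple zN aA bA dA.
- by apply: (@aperyN_triple a d b) => //; rewrite -addnA (addnC d) addnA.
- by apply: (@aperyN_triple b d a) => //; rewrite addnC addnA.
Qed.

Lemma adec3_nil t : adec3 = [::] -> t \in adec -> psum t.
Proof.
move=> D3 tD; apply: contraT => nps.
have : t \in adec3 by rewrite mem_filter nps.
by rewrite D3.
Qed.

Lemma adec_rep t : adec3 = [::] -> t \in adec ->
  exists x y, [/\ x \in aprim, y \in aprim, t = x + y & rwt t = wt x + wt y].
Proof.
move=> D3 tD; have [xP yP e] := repP (adec3_nil D3 tD).
by exists (rep t).1, (rep t).2.
Qed.

Lemma adec2E : adec3 = [::] -> adec2 = adec.
Proof.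
by move=> D3; apply/all_filterP/allP => t; apply: adec3_nil.
Qed.

Lemma wdec2_cubic z : adec3 = [::] -> z \in wdec2 ->
  exists a b d, [/\ a \in aprim, b \in aprim, d \in aprim & z = a + b + d].
Proof.
move=> D3 /wdec2_split[y [t [yP tD ez]]].
have [a [b [aP bP et _]]] := adec_rep D3 tD.
by exists y, a, b; split=> //; rewrite -addnA -et.
Qed.

Lemma wilf_adec0 : adec = [::] -> c <= 13 * size prims.
Proof.
move=> D0; apply: wilf_of_budget => //; rewrite /adec2 D0 !big_nil.
suff -> : wdec2 = [::] by rewrite big_nil !muln0.
case e : wdec2 => [|z s] //; have : z \in wdec2 by rewrite e inE eqxx.
by move=> /wdec2_split[y [t [_]]]; rewrite D0.
Qed.

(** In a triple summing to an element of [wdec2] all pair sums equal [t], so its entries agree and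
    [wdec2] has at most one element. *)
Lemma wilf_one_adec t : adec3 = [::] -> adec = [:: t] -> c <= 13 * size prims.
Proof.
move=> D3 D1; have tD : t \in adec by rewrite D1 inE.
have [x [y [xP yP et er]]] := adec_rep D3 tD.
have [xA yA] := (aprim_sub xP, aprim_sub yP).
have := adec_wt xA yA; rewrite -et => /(_ tD)[h1 h2 h3 h4 h5].
have p1 : 0 < size aprim by case: (aprim) xP.
have budget K : \sum_(z <- wdec2) cost z <= K ->
    depth + K <= (size aprim).+1 * wt t + rwt t -> c <= 13 * size prims.
  move=> hK hb; apply: wilf_of_budget => //.
  by rewrite adec2E // D1 !big_seq1 muln1; apply: leq_trans hb; rewrite leq_add2l.
case e : wdec2 => [|z s].
  by apply: (budget 0); rewrite ?e ?big_nil // er; nia.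
have zW : z \in wdec2 by rewrite e inE eqxx.
have tri a b d : a \in aprim -> b \in aprim -> d \in aprim ->
    a + b + d \in wdec2 -> [/\ a + b = t, a + d = t & b + d = t].
  move=> /aprim_sub aA /aprim_sub bA /aprim_sub dA /wdec2_triple[] //.
  by rewrite D1 !inE => /eqP -> /eqP -> /eqP ->.
have cub z' : z' \in wdec2 -> exists2 a, a \in aprim & z' = a + t /\ t = a + a.
  move=> zW'; have [a [b [d [aP bP dP ez]]]] := wdec2_cubic D3 zW'.
  have [] := tri a b d aP bP dP; first by rewrite -ez.
  by move=> e1 e2 e3; exists a => //; nlia.
have [a aP [ez ta]] := cub z zW.
have sub : {subset wdec2 <= [:: z]}.
  by move=> z' /cub[a' _ [ez' ta']]; rewrite inE; apply/eqP; nlia.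
have [e1 e2 _] : [/\ x + y = t, x + a = t & y + a = t].
  by apply: tri; rewrite // -et addnC -ez.
have ax : x = a by nlia.
have ay : y = a by nlia.
subst x y.
have tA := adec_sub tD.
have [k1 k2 k3] : [/\ cost (a + t) <= wt a + wt t,
    depth <= cost (a + t) + 1 & cost (a + t) <= depth].
  by apply: wdec_cost => //; rewrite -ez wdec2_sub.
have hK : \sum_(z' <- wdec2) cost z' <= cost z.
  by apply: leq_trans (sum_wdec2 sub) _; rewrite big_seq1 zW mul1n.
case: (ltnP 1 (size aprim)) => p2.
  apply: (budget _ hK); rewrite ez er; move: h1 h2 h3 h4 h5 k1 k2 k3 p2.
  by keep_nat; nia.
(* With one primitive element the budget reads [depth + cost z <= 2 * (wt a + wt t)]. *)
case: (leqP depth (wt a + wt t)) => hq.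
  by apply: (budget _ hK); rewrite ez er; keep_nat; nia.
(* The budget is short by one: [depth = 7] and [m <= 4]. *)
have aprimE : aprim = [:: a].
  by case e' : aprim aP p1 p2 => [|b [|? ?]] //; rewrite inE => /eqP ->.
have := weight13; rewrite aprimE D1 !big_seq1 => w13.
have wdecE : wdec = wdec2.
  apply/esym/all_filterP/allP => z'; rewrite mem_wdec => /and3P[/andP[cz' _] _ _].
  apply/negP => /repP[]; rewrite aprimE !inE => /eqP -> /eqP -> e'.
  have := apery_gt tA; nlia.
have := size_prims; have := size_apery_wdec; rewrite size_aperyE wdecE D1 /=.
have -> : size wdec2 = 1.
  by apply/eqP; rewrite eqn_leq (uniq_leq_size wdec2_uniq sub) e.
rewrite aprimE /= => m4 mE.
have q7 : depth = 7 by nlia.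
have /andP[c1 c2] := ceilP c m_gt0; rewrite -/depth q7 in c1 c2.
(* From [m = 5] on, [c <= 7 * m] and [size prims = m - 2] suffice. For [m = 4] the roundings in
   [wt a], [wt t] and [cost z] exclude [c > 26]. *)
case: (leqP m 4) => m5; last by nlia.
have m4' : m = 4 by nlia.
have /andP[d1 d2] := ceilP (c - a) m_gt0; rewrite -/(wt a) m4' in d1 d2.
have /andP[d3 d4] := ceilP (c - t) m_gt0; rewrite -/(wt t) m4' in d3 d4.
have /andP[d5 d6] := ceilP (2 * c - z) m_gt0; rewrite -/(cost z) m4' in d5 d6.
have := wdec2_lt zW; have := apery_gt tA; rewrite ez in d5 d6 *.
by rewrite m4' in c1 c2 mE *; nlia.
Qed.

(** Either [t1] or [t2] is a sum of two distinct primitive elements, or they are the doubles of two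
    distinct ones, each weighing at least half of [depth]. *)
Lemma adec_prims2 t1 t2 : adec3 = [::] -> t1 \in adec -> t2 \in adec ->
  t1 <> t2 -> exists a b, [/\ a \in aprim, b \in aprim, a <> b,
    depth <= wt a + wt b & 1 < wt a /\ 1 < wt b].
Proof.
move=> D3 t1D t2D t12.
have [a [b [aP bP e1 _]]] := adec_rep D3 t1D.
have [d [f [dP fP e2 _]]] := adec_rep D3 t2D.
have := adec_wt (aprim_sub aP) (aprim_sub bP);
  rewrite -e1 => /(_ t1D)[h1 _ h2 h3 h4].
have := adec_wt (aprim_sub dP) (aprim_sub fP);
  rewrite -e2 => /(_ t2D)[h5 _ h6 h7 h8].
case: (eqVneq a b) => [eab|/eqP nab]; last by exists a, b; split=> //; nlia.
case: (eqVneq d f) => [edf|/eqP ndf]; last by exists d, f; split=> //; nlia.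
subst b f; exists a, d; split=> //; nlia.
Qed.

Lemma sum_aprim_ge (s : seq nat) : uniq s -> {subset s <= aprim} ->
  \sum_(x <- s) wt x + size aprim <= \sum_(x <- aprim) wt x + size s.
Proof.
by move=> us /(leq_sum_size us aprim_uniq); apply => x /aprim_sub/wt_gt0.
Qed.

Lemma sum_adec_sub (s : seq nat) : uniq s -> {subset s <= adec} ->
  \sum_(x <- s) wt x + size adec <= \sum_(x <- adec) wt x + size s.
Proof.
by move=> us /(leq_sum_size us adec_uniq); apply => x /adec_sub/wt_gt0.
Qed.

Lemma wilf_two_adec t1 t2 : adec3 = [::] -> adec = [:: t1; t2] ->
  c <= 13 * size prims.
Proof.
move=> D3 D2.
have t1D : t1 \in adec by rewrite D2 inE eqxx.
have t2D : t2 \in adec by rewrite D2 !inE eqxx orbT.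
have t12 : t1 <> t2 by have := adec_uniq; rewrite D2 /= inE andbT => /eqP.
have inT t : t \in adec -> t = t1 \/ t = t2.
  by rewrite D2 !inE => /orP[]/eqP; [left | right].
have [a [b [aP bP nab wab [wa wb]]]] := adec_prims2 D3 t1D t2D t12.
have [x1 [y1 [x1P y1P e1 r1]]] := adec_rep D3 t1D.
have [x2 [y2 [x2P y2P e2 r2]]] := adec_rep D3 t2D.
have := adec_wt (aprim_sub x1P) (aprim_sub y1P);
  rewrite -e1 => /(_ t1D)[g1 g2 g3 g4 g5].
have := adec_wt (aprim_sub x2P) (aprim_sub y2P);
  rewrite -e2 => /(_ t2D)[k1 k2 k3 k4 k5].
have tri u v d : u \in aprim -> v \in aprim -> d \in aprim ->
    u + v + d \in wdec2 -> [/\ u + v \in adec, u + d \in adec & v + d \in adec].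
  by move=> /aprim_sub uA /aprim_sub vA /aprim_sub dA /wdec2_triple[].
have cub z : z \in wdec2 -> exists u v, [/\ u \in aprim, v \in aprim,
    z = u + u + v, u + u \in adec & u + v \in adec].
  move=> zW; have [u [v [d [uP vP dP ez]]]] := wdec2_cubic D3 zW.
  have [] := tri u v d uP vP dP; first by rewrite -ez.
  move=> uvD udD vdD.
  (* Three pair sums take at most two values, so two summands agree. *)
  have : [|| u == v, u == d | v == d].
    apply/negPn/negP; rewrite !negb_or => /and3P[/eqP ? /eqP ? /eqP ?].
    by case: (inT _ uvD) (inT _ udD) (inT _ vdD) => ? [] ? [] ?; nlia.
  case/or3P => /eqP eq.
  - by subst v; exists u, d; split.
  - by subst d; exists u, v; split=> //; nlia.
  - by subst d; exists v, u; split=> //; [nlia | rewrite addnC].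
(* If [z0 = 2 u + v] with [u <> v], then [adec] is [2 u, u + v] and the only
   other possible element is [3 u]; otherwise all elements are [3 u] with [2 u]
   in [adec]. *)
have [z1 [z2 sub]] : exists z1 z2, {subset wdec2 <= [:: z1; z2]}.
  (* [t + t./2] stands for [u + u + u] when [t = u + u]. *)
  have [/allP loops|/allPn[z0 z0W nloop]] :=
      boolP (all (fun z => (z == t1 + t1./2) || (z == t2 + t2./2)) wdec2).
    by exists (t1 + t1./2), (t2 + t2./2) => z /loops; rewrite !inE.
  have [u [v [uP vP ez0 uuD uvD]]] := cub z0 z0W.
  have nuv : u <> v.
    move=> euv; subst v; case/negP: nloop.
    by case: (inT _ uuD) => <-; rewrite ez0 addnn doubleK eqxx ?orbT.
  have inT' t : t \in adec -> t = u + u \/ t = u + v.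
    by move=> /inT et; case: (inT _ uuD) (inT _ uvD) et => ? [] ? [] ?; nlia.
  exists z0, (u + u + u) => z zW; rewrite !inE.
  have [d [f [dP fP ez ddD dfD]]] := cub z zW.
  case: (inT' _ ddD) => edd.
    have ? : d = u by nlia.
    by subst d; case: (inT' _ dfD) => edf; apply/orP; [right|left]; apply/eqP; nlia.
  have [df|/eqP ndf] := eqVneq d f.
    subst f; have [udD _ _] : [/\ u + d \in adec, u + v \in adec & d + v \in adec].
      by apply: tri => //; move: zW;
        rewrite ez edd (_ : u + d + v = u + v + d) //; nlia.
    by case: (inT' _ udD); nlia.
  have dfE : d + f = u + u by case: (inT' _ dfD) => //; nlia.
  have [_ duD _] : [/\ u + u \in adec, u + d \in adec & u + d \in adec].
    apply: tri => //; move: zW; rewrite ez (_ : d + d + f = u + u + d) //; nlia.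
  by case: (inT' _ duD); nlia.
have uab : uniq [:: a; b] by rewrite /= inE andbT; apply/eqP.
have sab : {subset [:: a; b] <= aprim} by move=> x; rewrite !inE => /orP[]/eqP->.
have := sum_aprim_ge uab sab; rewrite /= !big_cons big_nil addn0 => hab.
have p2 := uniq_leq_size uab sab; rewrite /= in p2.
have := weight13; rewrite D2 !big_cons big_nil addn0 => w13.
have budget K : \sum_(z <- wdec2) cost z <= K ->
    depth * 2 + K <= (size aprim).+1 * (wt t1 + wt t2) + (rwt t1 + rwt t2) ->
    c <= 13 * size prims.
  move=> hK hb; apply: wilf_of_budget => //.
  by rewrite adec2E // D2 !big_cons !big_nil !addn0; apply: leq_trans hb;
    rewrite leq_add2l.
have bound k : (forall z, z \in wdec2 -> cost z <= k) ->
    \sum_(z <- wdec2) cost z <= k + k.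
  move=> hk; apply: leq_trans (sum_wdec2 sub) _; rewrite !big_cons big_nil addn0.
  by apply: leq_add; case e: (_ \in wdec2); rewrite ?mul1n // hk.
have wtd : forall x, x \in aprim -> wt x < depth by move=> x /aprim_sub/wt_lt_depth.
have := wtd _ aP; have := wtd _ bP => wtb wta.
have q5 : depth <= 5 by nlia.
have p2E : size aprim <= 2 -> \sum_(x <- aprim) wt x = wt a + wt b.
  move=> p2'; have [_ ab] := uniq_min_size uab sab p2'.
  have pab : perm_eq aprim [:: a; b].
    by apply: uniq_perm aprim_uniq uab _ => x; rewrite ab.
  by rewrite (perm_big _ pab) !big_cons big_nil /= addn0.
have q3 : 2 < depth by have := wtd _ x1P; nlia.
have bq := bound depth wdec2_le.
(* With every cost bounded by [depth], it suffices that [2 * depth + 2 <= (size aprim).+2 * (wt t1 +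
   wt t2)]. This can fail for [depth = 5] with both weights 1, where the costs are shown to be at
   most 4. *)
have [/andP[/eqP q5' /eqP wT2]|nspec] :=
  boolP ((depth == 5) && (wt t1 + wt t2 == 2)).
  have wT1 t : t \in adec -> wt t = 1 by case/inT=> ->; nlia.
  have key : (forall u, u \in aprim -> 1 < wt u -> wt u <= 3) ->
      \sum_(z <- wdec2) cost z <= 4 + 4.
    move=> hu; apply: bound => z zW; have [u [v [uP vP ez uuD uvD]]] := cub z zW.
    have [h1 _ h2 _ _] := adec_wt (aprim_sub uP) (aprim_sub uP) uuD.
    have : u + (u + v) \in wdec by rewrite addnA -ez wdec2_sub.
    case/(wdec_cost (aprim_sub uP) (adec_sub uvD)) => h3 _ _.
    have := hu u uP; rewrite (wT1 _ uuD) in h1 h2; rewrite (wT1 _ uvD) in h3.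
    by rewrite ez -addnA; nlia.
  case: (leqP (size aprim) 2) => p2'.
    have [_ ab] := uniq_min_size uab sab p2'.
    have ab' x : x \in aprim -> x = a \/ x = b.
      by rewrite -ab !inE => /orP[]/eqP; [left | right].
    have := p2E p2'.
    move=> wE; rewrite wE in w13.
    have [wa3 wb3] : wt a = 3 /\ wt b = 3.
      by case: (ab' _ x1P) (ab' _ y1P) (ab' _ x2P) (ab' _ y2P)
        => ? [] ? [] ? [] ?; subst x1 y1 x2 y2; nlia.
    apply: (budget _ (key _)); first by move=> u /ab'[]->; nlia.
    have -> : rwt t1 = 6.
      by rewrite r1; case: (ab' _ x1P) (ab' _ y1P) => -> [] ->; nlia.
    have -> : rwt t2 = 6.
      by rewrite r2; case: (ab' _ x2P) (ab' _ y2P) => -> [] ->; nlia.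
    by rewrite wT2; nlia.
  apply: (budget _ (key _)); last by rewrite r1 r2 wT2; nlia.
  move=> u uP u1; have [->|nua] := eqVneq u a; first by nlia.
  have [->|nub] := eqVneq u b; first by nlia.
  have uuab : uniq [:: u; a; b] by rewrite cons_uniq uab andbT !inE negb_or nua.
  have suab : {subset [:: u; a; b] <= aprim}.
    by move=> x; rewrite !inE => /or3P[]/eqP->.
  by have := sum_aprim_ge uuab suab; rewrite /= !big_cons big_nil addn0; nlia.
apply: (budget _ bq); rewrite r1 r2.
(* If [aprim] were just [a] and [b], their weights, both below 4, would sum to 7. *)
have pq : depth = 4 -> wt t1 + wt t2 = 2 -> 2 < size aprim.
  move=> q v; rewrite ltnNge; apply/negP => /p2E wE; rewrite wE in w13.
  by rewrite q in w13 wta wtb; nlia.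
have hp : 8 <= (size aprim).+2 * (wt t1 + wt t2) by apply: (@leq_mul 4 2); nlia.
have [q|[q|q]] : depth = 3 \/ depth = 4 \/ depth = 5 by nlia.
- by rewrite q in g1 k1 *; nlia.
- rewrite q in g1 k1 *; suff : 10 <= (size aprim).+2 * (wt t1 + wt t2) by nlia.
  have [v|v] : wt t1 + wt t2 = 2 \/ 2 < wt t1 + wt t2 by nlia.
    by have := pq q v; rewrite v; nlia.
  by apply: (@leq_trans (4 * 3)); last exact: leq_mul.
- have v : 2 < wt t1 + wt t2 by move: nspec; rewrite q eqxx /=; nlia.
  rewrite q in g1 k1 *; suff : 12 <= (size aprim).+2 * (wt t1 + wt t2) by nlia.
  exact: (@leq_mul 4 3).
Qed.

(** * Three or more decomposable Apery elements *)

(* Only primitive elements of weight at least two divide an element of [adec]. *)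
Definition heavy : seq nat := [seq x <- aprim | 1 < wt x].

Lemma heavy_uniq : uniq heavy. Proof. exact/filter_uniq/aprim_uniq. Qed.

Lemma mem_heavy x : (x \in heavy) = (x \in aprim) && (1 < wt x).
Proof. by rewrite mem_filter andbC. Qed.

Lemma heavyI x y : x \in aprim -> y \in aprim -> x + y \in adec -> x \in heavy.
Proof.
move=> xP yP xyD; rewrite mem_heavy xP /=.
by have [_ _ h1 _ h2] := adec_wt (aprim_sub xP) (aprim_sub yP) xyD; nlia.
Qed.

Lemma sum_heavy :
  \sum_(x <- aprim) wt x + size heavy = \sum_(x <- heavy) wt x + size aprim.
Proof.
rewrite (bigID (fun x => 1 < wt x)) /= -big_filter -/heavy -addnA; congr addn.
have -> : \sum_(x <- aprim | ~~ (1 < wt x)) wt x =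
    \sum_(x <- aprim | ~~ (1 < wt x)) 1.
  rewrite big_seq_cond [RHS]big_seq_cond; apply: eq_bigr => x.
  by move=> /andP[/aprim_sub/wt_gt0]; nlia.
by rewrite sum1_count /heavy size_filter addnC count_predC.
Qed.

Lemma sum_heavy_ge : 2 * size heavy <= \sum_(x <- heavy) wt x.
Proof.
rewrite -sum1_size big_distrr /= big_seq [X in _ <= X]big_seq.
by apply: leq_sum => x; rewrite mem_heavy => /andP[].
Qed.

Lemma sum_adec_ge : size adec <= \sum_(x <- adec) wt x.
Proof.
rewrite -sum1_size big_seq [X in _ <= X]big_seq.
by apply: leq_sum => x /adec_sub/wt_gt0.
Qed.

Lemma adec_heavy t : adec3 = [::] -> t \in adec ->
  exists x y, [/\ x \in heavy, y \in heavy, t = x + y & rwt t = wt x + wt y].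
Proof.
move=> D3 tD; have [x [y [xP yP et er]]] := adec_rep D3 tD.
exists x, y; split=> //; first by apply: heavyI yP _; rewrite // -et.
by apply: heavyI xP _; rewrite // addnC -et.
Qed.

Lemma wdec2_heavy z : adec3 = [::] -> z \in wdec2 ->
  exists x y d, [/\ x \in heavy, y \in heavy, d \in heavy & z = x + y + d].
Proof.
move=> D3 zW; have [x [y [d [xP yP dP ez]]]] := wdec2_cubic D3 zW.
have [] := @wdec2_triple x y d; rewrite -?ez ?aprim_sub // => xyD xdD ydD.
exists x, y, d; split=> //; [exact: heavyI yP _ | exact: heavyI dP _ |].
by apply: heavyI xP _; rewrite // addnC.
Qed.

(** All three sums of two heavy elements must lie in [adec], and [wdec2] consists of some of the
    four sums of three. *)
Lemma wilf_heavy2 a b : adec3 = [::] -> heavy = [:: a; b] -> 2 < size adec ->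
  c <= 13 * size prims.
Proof.
move=> D3 H2 D_ge3.
have nab : a <> b by have := heavy_uniq; rewrite H2 /= inE andbT => /eqP.
have ab x : x \in heavy -> x = a \/ x = b.
  by rewrite H2 !inE => /orP[]/eqP; [left | right].
have /andP[aP wa] : (a \in aprim) && (1 < wt a) by rewrite -mem_heavy H2 inE eqxx.
have /andP[bP wb] : (b \in aprim) && (1 < wt b).
  by rewrite -mem_heavy H2 !inE eqxx orbT.
have [aA bA] := (aprim_sub aP, aprim_sub bP).
pose l := [:: a + a; a + b; b + b].
have sl : {subset adec <= l}.
  move=> t /(adec_heavy D3)[x [y [/ab xH /ab yH -> _]]]; rewrite !inE.
  by case: xH yH => -> [] ->; rewrite ?eqxx ?orbT // addnC eqxx orbT.
have [_ lD] := uniq_min_size adec_uniq sl D_ge3.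
have ul := leq_size_uniq adec_uniq sl D_ge3.
have pl : perm_eq adec l by apply: (uniq_perm adec_uniq ul) => x; rewrite lD.
have aaD : a + a \in adec by rewrite lD inE eqxx.
have abD : a + b \in adec by rewrite lD !inE eqxx orbT.
have bbD : b + b \in adec by rewrite lD !inE eqxx !orbT.
have [u1 u2 u3 _ u5] := adec_wt aA aA aaD.
have [v1 v2 v3 v4 v5] := adec_wt aA bA abD.
have [w1 w2 w3 _ w5] := adec_wt bA bA bbD.
have := weight13; rewrite (perm_big _ pl) !big_cons big_nil /= addn0 => w13.
have := sum_heavy; rewrite H2 !big_cons big_nil /= addn0 => sH.
have p2 : size heavy <= size aprim by rewrite size_filter count_size.
rewrite H2 /= in p2.
have wta := wt_lt_depth aA; have wtb := wt_lt_depth bA.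
have q4 : depth <= 4 by nlia.
have q3 : 2 < depth by nlia.
have r1 : rwt (a + a) = wt a + wt a.
  have [x [y [/ab xH /ab yH e ->]]] := adec_heavy D3 aaD.
  by case: xH yH e => -> [] ->; nlia.
have r2 : rwt (a + b) = wt a + wt b.
  have [x [y [/ab xH /ab yH e ->]]] := adec_heavy D3 abD.
  by case: xH yH e => -> [] ->; nlia.
have r3 : rwt (b + b) = wt b + wt b.
  have [x [y [/ab xH /ab yH e ->]]] := adec_heavy D3 bbD.
  by case: xH yH e => -> [] ->; nlia.
pose f z := (z \in wdec2) * cost z.
have sub : {subset wdec2 <= [:: a + (a + a); a + (a + b); b + (a + b); b + (b + b)]}.
  move=> z /(wdec2_heavy D3)[x [y [d [/ab xH /ab yH /ab dH ->]]]].
  exact: mem_cubics2.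
have := sum_wdec2 sub; rewrite !big_cons big_nil addn0 -!/(f _) => K2.
have fle x t : x \in aprim -> t \in adec -> f (x + t) <= wt x + wt t.
  move=> /aprim_sub xA /adec_sub tA; rewrite /f.
  by case e: (_ \in wdec2); rewrite // mul1n;
    have [] := wdec_cost xA tA (wdec2_sub e).
have fq z : f z <= depth.
  by rewrite /f; case e: (_ \in wdec2); rewrite // mul1n wdec2_le.
have f1 := fle _ _ aP aaD; have f2 := fle _ _ aP abD; have f2' := fle _ _ bP aaD.
have f3 := fle _ _ bP abD; have f3' := fle _ _ aP bbD; have f4 := fle _ _ bP bbD.
rewrite (_ : b + (a + a) = a + (a + b)) in f2'; last by nlia.
rewrite (_ : a + (b + b) = b + (a + b)) in f3'; last by nlia.
have g1 := fq (a + (a + a)); have g2 := fq (a + (a + b)).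
have g3 := fq (b + (a + b)); have g4 := fq (b + (b + b)).
have budget : depth * 3 +
    (f (a + (a + a)) + (f (a + (a + b)) + (f (b + (a + b)) + f (b + (b + b))))) <=
    (size aprim).+1 * (wt (a + a) + (wt (a + b) + wt (b + b))) +
    3 * (wt a + wt b) -> c <= 13 * size prims.
  move=> hb; apply: wilf_of_budget => //.
  rewrite adec2E // !(perm_big _ pl) (perm_size pl) !big_cons !big_nil /= !addn0 r1 r2 r3.
  by move: hb K2; nlia.
(* For these weights [size aprim = 2] and [adec] weighs 3, so the budget is [12 + K <= 27], where
   [K] is the sum of the [f] values; only [K = 16] violates it. *)
have [/and4P[/eqP q /eqP wa3 /eqP wb3 /eqP Keq]|nexc] :=
  boolP [&& depth == 4, wt a == 3,
    wt b == 3 & f (a + (a + a)) + (f (a + (a + b)) + (f (b + (a + b)) +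
    f (b + (b + b)))) == 16]; last first.
  apply: budget.
  have pE : size aprim = 15 - depth - (wt a + wt b) -
      (wt (a + a) + (wt (a + b) + wt (b + b))) by nlia.
  rewrite pE; move: nexc; rewrite !negb_and.
  have [q|q] : depth = 3 \/ depth = 4 by nlia.
    have -> : wt a = 2 by nlia.
    have -> : wt b = 2 by nlia.
    have -> : wt (a + a) = 1 by nlia.
    have -> : wt (a + b) = 1 by nlia.
    have -> : wt (b + b) = 1 by nlia.
    by rewrite q in g1 g2 g3 g4 *; nlia.
  rewrite q in u1 u2 v1 v2 w1 w2 w13 wta wtb g1 g2 g3 g4 *.
  have [A|A] : wt a = 2 \/ wt a = 3 by nlia.
  - have [B|B] : wt b = 2 \/ wt b = 3 by nlia.
    + by rewrite A B in u1 u2 u3 v1 v2 v3 v4 w1 w2 w3 w13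
        f1 f2 f3 f4 f2' f3' *;
      keep_nat; split12 (wt (a + a)); split12 (wt (b + b)); split12 (wt (a + b)); nia.
    + by rewrite A B in u1 u2 u3 v1 v2 v3 v4 w1 w2 w3 w13
        f1 f2 f3 f4 f2' f3' *;
      keep_nat; split12 (wt (a + a)); split12 (wt (b + b)); split12 (wt (a + b)); nia.
  - have [B|B] : wt b = 2 \/ wt b = 3 by nlia.
    + by rewrite A B in u1 u2 u3 v1 v2 v3 v4 w1 w2 w3 w13
        f1 f2 f3 f4 f2' f3' *;
      keep_nat; split12 (wt (a + a)); split12 (wt (b + b)); split12 (wt (a + b)); nia.
    + by rewrite A B in u1 u2 u3 v1 v2 v3 v4 w1 w2 w3 w13
        f1 f2 f3 f4 f2' f3' *;
      keep_nat; split12 (wt (a + a)); split12 (wt (b + b)); split12 (wt (a + b)); nia.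
(* The budget is short by one: then [m = 10] and [c = 40] force [a] or [b] to be
   [15], but [30 - m] is [2 m]. *)
rewrite q in g1 g2 g3 g4 w13; rewrite wa3 wb3 in sH.
have inW z : f z = 4 -> z \in wdec2 by rewrite /f; case: (_ \in _).
have W1 : a + (a + a) \in wdec2 by apply: inW; nlia.
have W2 : a + (a + b) \in wdec2 by apply: inW; nlia.
have W3 : b + (a + b) \in wdec2 by apply: inW; nlia.
have W4 : b + (b + b) \in wdec2 by apply: inW; nlia.
have p2' : size aprim <= size heavy by rewrite H2 /=; nlia.
have [_ HP] := uniq_min_size heavy_uniq (mem_subseq (filter_subseq _ _)) p2'.
have wdecE : wdec = wdec2.
  apply/esym/all_filterP/allP => z; rewrite mem_wdec => /and3P[/andP[cz _] _ _].
  apply/negP => /repP[]; rewrite -!HP => /ab xE /ab yE.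
  have := apery_gt (adec_sub aaD); have := apery_gt (adec_sub abD).
  have := apery_gt (adec_sub bbD).
  by case: xE yE => -> [] ->; nlia.
have W4s : size wdec = 4.
  apply/eqP; rewrite wdecE eqn_leq (uniq_leq_size wdec2_uniq sub) /=.
  apply: (@uniq_leq_size _ [:: a + (a + a); a + (a + b); b + (a + b); b + (b + b)]).
    rewrite /= !inE !negb_or.
    by keep_nat; repeat (apply/andP; split); apply/eqP; lia.
  by move=> z; rewrite !inE => /or4P[]/eqP->.
have := size_prims; have := size_apery_wdec;
  rewrite size_aperyE (perm_size pl) W4s /=.
move=> m10 mE.
have [c1 c2] := andP (ceilP c m_gt0); rewrite -/depth q in c1 c2.
(* From [m = 11] on, [c <= 4 * m] is at most [13 * (m - 7)]; for [m = 10] only [c = 40] remains. *)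
have [m11|m11] : 10 < m \/ m = 10 by nlia.
  by nlia.
have [h1 h2] := andP (ceilP (c - (a + a)) m_gt0); rewrite -/(wt (a + a)) in h1 h2.
have [h3 h4] := andP (ceilP (c - (b + b)) m_gt0); rewrite -/(wt (b + b)) in h3 h4.
have := wdec2_lt W1; have := wdec2_lt W4.
have : ~~ S (a + a - m) by move/adec_sub: aaD; rewrite mem_apery => /and3P[].
have : ~~ S (b + b - m) by move/adec_sub: bbD; rewrite mem_apery => /and3P[].
rewrite m11 in h1 h2 h3 h4 c1 c2 mE *.
have S20 : S 20 by rewrite (_ : 20 = m + m) ?SD // m11.
have [|c40] := leqP c 39; first by nlia.
have [aa1 bb1] : wt (a + a) = 1 /\ wt (b + b) = 1 by nlia.
rewrite aa1 bb1 in h1 h2 h3 h4.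
move=> nb na lb la.
(* Weight 1 of the doubles gives [a, b >= 15], the triples below 50 give [a, b <= 16], and
   [a <> b]. *)
have [a15|b15] : a = 15 \/ b = 15 by nlia.
  by rewrite a15 S20 in na.
by rewrite b15 S20 in nb.
Qed.

(** The total 13 forces weight 2 on [heavy] and 1 on [adec], so each cost in [wdec2] is at most 3
    and [cubic_count] bounds their number. *)
Lemma wilf_heavy3 : adec3 = [::] -> size heavy = 3 -> 2 < size adec ->
  c <= 13 * size prims.
Proof.
move=> D3 H3 D_ge3.
have sH := sum_heavy; have gH := sum_heavy_ge; have gD := sum_adec_ge.
have p3 : size heavy <= size aprim by rewrite size_filter count_size.
have w13 := weight13; rewrite H3 in sH gH p3.
have wlt x : x \in heavy -> 1 < wt x < depth.
  by rewrite mem_heavy => /andP[/aprim_sub/wt_lt_depth -> ->].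
have [x [y [z [xyz Hxyz]]]] : exists x y z, x < y < z /\ perm_eq heavy [:: x; y; z].
  have : perm_eq (sort leq heavy) heavy by rewrite perm_sort.
  have := sort_sorted leq_total heavy.
  have : uniq (sort leq heavy) by rewrite sort_uniq heavy_uniq.
  have : size (sort leq heavy) = 3 by rewrite size_sort.
  case: (sort leq heavy) => [|x [|y [|z []]]] //= _.
  rewrite !inE negb_or andbT => /andP[/andP[/eqP nxy _] /eqP nyz].
  move=> /and3P[xy yz _] pH; exists x, y, z; split; last by rewrite perm_sym.
  by nlia.
have mH := perm_mem Hxyz.
have eH : \sum_(u <- heavy) wt u = wt x + (wt y + wt z).
  by rewrite (perm_big _ Hxyz) !big_cons big_nil /= addn0.
have [xH yH zH] : [/\ x \in heavy, y \in heavy & z \in heavy].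
  by rewrite !mH !inE !eqxx !orbT.
have := wlt _ xH; have := wlt _ yH;
  have := wlt _ zH => /andP[z1 z2] /andP[y1 y2] /andP[x1 x2].
have q34 : depth = 3 \/ depth = 4 by nlia.
(* For [depth = 3] heavy weights are below 3; for [depth = 4] the total leaves at most 6 for all
   three. *)
have [wx [wy wz]] : wt x = 2 /\ wt y = 2 /\ wt z = 2 by case: q34; nlia.
have wH u : u \in heavy -> wt u = 2.
  by rewrite mH !inE => /or3P[]/eqP->.
have aH u : u \in heavy -> u \in apery by rewrite mem_heavy => /andP[/aprim_sub].
have wD t : t \in adec -> wt t = 1.
  move=> tD; have [u [v [uH vH et _]]] := adec_heavy D3 tD.
  have := adec_wt (aH _ uH) (aH _ vH);
    rewrite -et (wH _ uH) => /(_ tD)[_ _ h1 _ h2].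
  by nlia.
have rD t : t \in adec -> rwt t = 4.
  by move=> tD; have [u [v [uH vH _ ->]]] := adec_heavy D3 tD; rewrite !wH.
have eD : \sum_(t <- adec) wt t = size adec.
  by rewrite -sum1_size; apply: eq_big_seq.
have eR : \sum_(t <- adec) rwt t = 4 * size adec.
  by rewrite -sum1_size big_distrr; apply: eq_big_seq.
have K2 : \sum_(u <- wdec2) cost u <= 3 * size wdec2.
  rewrite -sum1_size big_distrr /= big_seq [X in _ <= X]big_seq.
  apply: leq_sum => u uW; have [a [b [d [aX bX dX eu]]]] := wdec2_heavy D3 uW.
  have [] := @wdec2_triple a b d; rewrite -?eu ?aH // => _ _ bdD.
  have : a + (b + d) \in wdec by rewrite addnA -eu wdec2_sub.
  case/(wdec_cost (aH _ aX) (adec_sub bdD)) => h _ _.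
  by rewrite eu -addnA; apply: leq_trans h _; rewrite (wH _ aX) (wD _ bdD).
have [] := @cubic_count x y z adec wdec2 xyz adec_uniq wdec2_uniq.
- by move=> t /(adec_heavy D3)[u [v [uH vH et _]]]; exists u, v; rewrite -!mH.
- by move=> u /(wdec2_heavy D3)[a [b [d [aX bX dX eu]]]]; exists a, b, d;
  rewrite -!mH.
- by move=> a b d; rewrite -!mH => /aH aX /aH bX /aH dX /wdec2_triple[].
move=> s3 s4; apply: wilf_of_budget => //; rewrite adec2E // eD eR.
have [t3|t4] : size adec = 3 \/ (size adec = 4 /\ depth = 3) by case: q34; nlia.
  by have := s3 t3; rewrite t3; case: q34 => q; rewrite q in w13 *; nlia.
case: t4 => t4 q; have := s4 t4; rewrite t4 q in w13 *; rewrite eD t4 in w13.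
by nlia.
Qed.

(** One heavy element yields at most one decomposable; four would exceed the total weight 13. *)
Lemma wilf_adec3_nil : adec3 = [::] -> c <= 13 * size prims.
Proof.
move=> D3; case D : adec => [|t1 [|t2 [|t3 s]]].
- exact: wilf_adec0.
- exact: wilf_one_adec D3 D.
- exact: wilf_two_adec D3 D.
have D_ge3 : 2 < size adec by rewrite D.
have sH := sum_heavy; have gH := sum_heavy_ge; have gD := sum_adec_ge.
have p3 : size heavy <= size aprim by rewrite size_filter count_size.
have w13 := weight13.
have hD := adec_heavy D3; case H : heavy => [|a [|b [|d l]]].
- by have [|x [y []]] := hD t1; rewrite ?H // D inE eqxx.
- suff : size adec <= 1 by nlia.
  apply: (@uniq_leq_size _ _ [:: a + a] adec_uniq) => t /hD[x [y []]].
  by rewrite H !inE => /eqP -> /eqP -> ->.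
- exact: wilf_heavy2 D3 H D_ge3.
have q3 : 2 < depth.
  have := wt_lt_depth (_ : a \in apery).
  have : a \in heavy by rewrite H inE eqxx.
  by rewrite mem_heavy => /andP[/aprim_sub aA a1] /(_ aA); nlia.
apply: wilf_heavy3 => //; have : 2 < size heavy by rewrite H.
by nlia.
Qed.

(** * Decomposable Apery elements of length three *)

(* Other sums would make the total weight exceed 13. *)
Lemma adec3_triple t : t \in adec3 -> exists a,
  [/\ a \in aprim, a + a \in adec & t = a + (a + a)].
Proof.
rewrite mem_filter => /andP[npt tD]; have tA := adec_sub tD.
have tN := apery_aperyN tA; have w13 := weight13.
have [|y [v [yP vA et]]] := dec_split tN; first by move: tD;
  rewrite mem_adec => /andP[].
have vD : v \in adec.
  case/orP: (apery_prim_or_dec vA) => // vP.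
  by move: npt; rewrite et psumI.
have [|a [u [aP uA ev]]] := dec_split (apery_aperyN vA).
  by move: vD; rewrite mem_adec => /andP[].
have [yA aA] := (aprim_sub yP, aprim_sub aP).
have := adec_wt yA vA; rewrite -et => /(_ tD)[_ _ _ tv t0].
have := adec_wt aA uA; rewrite -ev => /(_ vD)[_ _ va vu v0].
have wa := wt_lt_depth aA.
(* With four summands, [0 < wt t < wt v < wt u < wt b < depth] makes the total at least 15. *)
case/orP: (apery_prim_or_dec uA) => [uP|uD]; last first.
  have [|b [d [bP dA eu]]] := dec_split (apery_aperyN uA).
    by move: uD; rewrite mem_adec => /andP[].
  have := adec_wt (aprim_sub bP) dA; rewrite -eu => /(_ uD)[_ _ ub _ _].
  have wb := wt_lt_depth (aprim_sub bP).
  have := apery_gt yA; have := apery_gt aA => a0 y0.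
  have us : uniq [:: t; v; u].
    rewrite /= !inE negb_or; move: et ev a0 y0; clear => *.
    by repeat (apply/andP; split) => //; apply/eqP; lia.
  have ss : {subset [:: t; v; u] <= adec} by move=> x;
    rewrite !inE => /or3P[]/eqP->.
  have := sum_adec_sub us ss; have := uniq_leq_size us ss.
  have ub1 : uniq [:: b] by [].
  have sb : {subset [:: b] <= aprim} by move=> x; rewrite inE => /eqP ->.
  have := sum_aprim_ge ub1 sb; have := uniq_leq_size ub1 sb.
  by rewrite !big_cons !big_nil /=; nlia.
have uA' := aprim_sub uP.
(* Here [t], [b + f], [d + f] weigh at least 1, 2, 2, while [depth >= 4] and [b], [d] together weigh
   at least [depth + 1]: the total would be at least 14. *)
have distinct b d f : b \in aprim -> d \in aprim -> f \in aprim ->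
    t = b + d + f -> b <> d -> False.
  move=> bP dP fP etx nbd.
  have [bA dA fA] := And3 (aprim_sub bP) (aprim_sub dP) (aprim_sub fP).
  have bdD : b + d \in adec by apply: (@aperyN_triple _ _ f); rewrite // -etx.
  have bfD : b + f \in adec.
    by apply: (@aperyN_triple _ _ d) => //; rewrite -addnA (addnC f) addnA -etx.
  have dfD : d + f \in adec.
    by apply: (@aperyN_triple _ _ b) => //; rewrite addnC addnA -etx.
  have := adec_wt fA (adec_sub bdD); rewrite addnC -etx => /(_ tD)[_ _ _ h1 _].
  have := adec_wt dA (adec_sub bfD);
    rewrite addnCA addnA -etx => /(_ tD)[_ _ _ h2 _].
  have := adec_wt bA (adec_sub dfD); rewrite addnA -etx => /(_ tD)[_ _ _ h3 _].
  have [h4 _ _ _ _] := adec_wt bA dA bdD.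
  have := apery_gt bA; have := apery_gt dA => d0 b0.
  have us : uniq [:: t; b + f; d + f].
    rewrite /= !inE negb_or; move: etx nbd b0 d0; clear => *.
    by repeat (apply/andP; split) => //; apply/eqP; lia.
  have ss : {subset [:: t; b + f; d + f] <= adec}.
    by move=> x; rewrite !inE => /or3P[]/eqP->.
  have := sum_adec_sub us ss; have := uniq_leq_size us ss.
  have ub : uniq [:: b; d] by rewrite /= inE andbT; apply/eqP.
  have sb : {subset [:: b; d] <= aprim} by move=> x; rewrite !inE => /orP[]/eqP->.
  have := sum_aprim_ge ub sb; have := uniq_leq_size ub sb.
  by rewrite !big_cons !big_nil /=; nlia.
have [eya|/eqP nya] := eqVneq y a; last first.
  by case: (distinct y a u) => //; rewrite et ev addnA.
have [eua|/eqP nua] := eqVneq u a; last first.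
  by case: (distinct u a y) => //; rewrite et ev addnC (addnC a).
by exists a; subst y u; split; rewrite // -ev.
Qed.

(** Here [t = 3 a]. If [adec] is just [2 a] and [3 a], then [wdec2] contains at most [4 a]; a
    further decomposable element pins down all weights. *)
Lemma wilf_adec3 t : t \in adec3 -> c <= 13 * size prims.
Proof.
move=> t3; have [a [aP aaD et]] := adec3_triple t3.
have [npt tD] : ~~ psum t /\ t \in adec by move: t3; rewrite mem_filter => /andP[].
have aA := aprim_sub aP; have aaA := adec_sub aaD; have wa := wt_lt_depth aA.
have [h1 _ h2 _ h3] := adec_wt aA aA aaD.
have := adec_wt aA aaA; rewrite -et => /(_ tD)[h4 _ _ h5 h6].
have aa2 : a + a \in adec2 by rewrite mem_filter psumI.
have w13 := weight13.
have a0 := apery_gt aA.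
have naa x : x \in aprim -> x <> a + a.
  by move=> xP ex; apply: (@aprim_adec x); rewrite // ex.
have raa : depth + wt (a + a) <= rwt (a + a) + 1.
  have [xP yP e] := repP (psumI aP aP).
  by have := adec_wt (aprim_sub xP) (aprim_sub yP); rewrite e => /(_ aaD)[].
have r2 t' : t' \in adec2 -> depth + wt t' <= rwt t' + 1.
  rewrite mem_filter => /andP[/repP[xP yP e] tD'].
  by have := adec_wt (aprim_sub xP) (aprim_sub yP); rewrite e => /(_ tD')[].
have tri x y u : aperyN (x + y + u) -> x \in aprim -> y \in aprim -> u \in apery ->
    x + y \in adec.
  by move=> h /aprim_sub xA /aprim_sub yA uA; apply: aperyN_triple h xA yA uA.
have ulist : uniq [:: a + a; t].
  by rewrite /= inE andbT; apply/eqP; rewrite et; nlia.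
have slist : {subset [:: a + a; t] <= adec}.
  by move=> x; rewrite !inE => /orP[]/eqP->.
have usa : uniq [:: a] by [].
have ssa : {subset [:: a] <= aprim} by move=> x; rewrite inE => /eqP->.
have := sum_aprim_ge usa ssa; have := uniq_leq_size usa ssa.
rewrite !big_cons big_nil /= addn0 => p1 hp.
have [/allP small|/allPn[t' t'D nt']] :=
  boolP (all (fun x => (x == a + a) || (x == t)) adec).
  have sub2 : {subset adec <= [:: a + a; t]} by move=> x /small; rewrite !inE.
  have pD : perm_eq adec [:: a + a; t].
    apply: uniq_perm adec_uniq ulist _ => x; apply/idP/idP; first exact: sub2.
    exact: slist.
  have eD : \sum_(x <- adec) wt x = wt (a + a) + wt t.
    by rewrite (perm_big _ pD) !big_cons big_nil /= addn0.
  have sub : {subset wdec2 <= [:: (a + a) + (a + a)]}.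
    move=> z zW; have zN := wdec_aperyN (wdec2_sub zW).
    have [y [u [yP uD ez]]] := wdec2_split zW.
    (* As [y + a] is [2 a] or [3 a] and [y] is primitive, [y = a]; then [z] is [4 a], since [3 a]
       lies below [c]. *)
    have yaD : y + a \in adec.
      have := small u uD => /orP[]/eqP eu.
        by apply: (tri _ _ a) => //; rewrite -addnA -eu -ez.
      by apply: (tri _ _ (a + a)) => //; rewrite -addnA -et -eu -ez.
    have ya : y = a.
      have := small _ yaD => /orP[]/eqP e; first by nlia.
      by case: (naa y yP); nlia.
    have := small u uD => /orP[]/eqP eu; last first.
      by rewrite inE; apply/eqP; nlia.
    have zt : z = t by nlia.
    by have := wdec2_ge zW; have := apery_gt (adec_sub tD); nlia.
  have K2 : \sum_(z <- wdec2) cost z <= (a + a + (a + a) \in wdec2) * cost (a + a + (a + a)).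
    by apply: leq_trans (sum_wdec2 sub) _; rewrite big_seq1.
  have p1E : size aprim <= 1 -> \sum_(x <- aprim) wt x = wt a.
    move=> p1'; have [_ ab] := uniq_min_size usa ssa p1'.
    have pab : perm_eq aprim [:: a] by apply: uniq_perm aprim_uniq usa _ => x;
      rewrite ab.
    by rewrite (perm_big _ pab) big_seq1.
  have R2 : rwt (a + a) <= \sum_(x <- adec2) rwt x.
    rewrite -(big_seq1 addn (a + a) rwt); apply: leq_sum_sub => // x.
    by rewrite inE => /eqP ->.
  have K3 : \sum_(z <- wdec2) cost z <= minn depth (2 * wt (a + a)) /\
      (0 < \sum_(z <- wdec2) cost z -> depth <= 2 * wt (a + a) + 1).
    move: K2; case e: (_ \in wdec2); last by rewrite mul0n leqn0 => /eqP ->.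
    rewrite mul1n => K2; have [k1 k2 k3] := wdec_cost aaA aaA (wdec2_sub e).
    by split; nlia.
  apply: wilf_of_budget => //; rewrite (perm_size pD) eD /=.
  rewrite eD in w13; case: K3 => K3 K4.
  move: (\sum_(z <- wdec2) cost z) K3 K4 => K K3 K4 {K2}.
  have q6 : depth <= 6 by nlia.
  have K5 : K <= 0 \/ depth <= 2 * wt (a + a) + 1.
    by case: (posnP K) => [->|/K4]; [left | right].
  have [pE|p2] : size aprim = 1 \/ 1 < size aprim by nlia.
    have := p1E _; rewrite pE => /(_ isT) wE; rewrite wE in w13.
    have [q|[q|q]] : depth = 4 \/ depth = 5 \/ depth = 6 by nlia.
    + by rewrite q in wa h1 h4 raa w13 K3 K5 *; case: K5 => K5; nlia.
    + by rewrite q in wa h1 h4 raa w13 K3 K5 *; case: K5 => K5; nlia.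
    + by rewrite q in wa h1 h4 raa w13 K3 K5 *; case: K5 => K5; nlia.
  have p3 : 3 * (wt (a + a) + wt t) <= (size aprim).+1 * (wt (a + a) + wt t).
    exact: leq_mul.
  by case: K5 => K5; nlia.
move: nt'; rewrite negb_or => /andP[/eqP nt'a /eqP nt't].
(* Otherwise [t' = 3 b]; the doubles and triples of [a] and [b] weigh at least 6, [a] and [b] at
   least 6, and [depth >= 4], too much in all. *)
have t'2 : t' \in adec2.
  rewrite mem_filter t'D andbT; apply: contraT => npt'.
  have [|b [bP bbD et']] := @adec3_triple t'; first by rewrite mem_filter npt'.
  have nab : a <> b by move=> eab; case: nt't; rewrite et' et eab.
  have bA := aprim_sub bP; have b0 := apery_gt bA.
  have [k1 _ k2 _ k3] := adec_wt bA bA bbD.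
  have := adec_wt bA (adec_sub bbD); rewrite -et' => /(_ t'D)[k4 _ _ k5 k6].
  have us : uniq [:: a + a; b + b; t; t'].
    have n1 : b + b != t by apply: contraNneq npt => <-; apply: psumI.
    have n2 : a + a != t' by apply: contraNneq npt' => <-; apply: psumI.
    rewrite /= !inE !negb_or n1 n2; move: et et' nab a0 b0; clear => *.
    by repeat (apply/andP; split) => //; apply/eqP; lia.
  have ss : {subset [:: a + a; b + b; t; t'] <= adec}.
    by move=> x; rewrite !inE => /or4P[]/eqP->.
  have := sum_adec_sub us ss; have := uniq_leq_size us ss.
  have ub : uniq [:: a; b] by rewrite /= inE andbT; apply/eqP.
  have sb : {subset [:: a; b] <= aprim} by move=> x; rewrite !inE => /orP[]/eqP->.
  have := sum_aprim_ge ub sb; have := uniq_leq_size ub sb.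
  by rewrite !big_cons !big_nil /=; nlia.
have [b [e [bP eP nab et']]] : exists b e,
    [/\ b \in aprim, e \in aprim, a <> b & t' = b + e].
  have /repP[] : psum t' by move: t'2; rewrite mem_filter => /andP[].
  move: (rep t').1 (rep t').2 => x y xP yP exy.
  have [exa|/eqP nxa] := eqVneq a x; last by exists x, y.
  by exists y, x; split=> //; nlia.
have bA := aprim_sub bP; have eA := aprim_sub eP; have b0 := apery_gt bA.
have [k1 _ k2 _ k3] : [/\ depth + wt t' <= wt b + wt e + 1,
    wt b + wt e <= depth + wt t' + 1, wt t' < wt b, wt t' < wt e & 0 < wt t'].
  by rewrite et'; apply: adec_wt; rewrite // -et'.
have us : uniq [:: a + a; t; t'].
  rewrite /= !inE !negb_or; move: et nt'a nt't a0; clear => *.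
  by repeat (apply/andP; split) => //; apply/eqP; lia.
have ss : {subset [:: a + a; t; t'] <= adec} by move=> x;
  rewrite !inE => /or3P[]/eqP->.
have ub : uniq [:: a; b] by rewrite /= inE andbT; apply/eqP.
have sb : {subset [:: a; b] <= aprim} by move=> x; rewrite !inE => /orP[]/eqP->.
have := sum_adec_sub us ss; have := uniq_leq_size us ss.
have := sum_aprim_ge ub sb; have := uniq_leq_size ub sb.
rewrite !big_cons !big_nil /= !addn0 => p2 hab d3 hD.
(* The least values of [depth], [wt a], [wt b] and of the weights of [2 a], [t], [t'] are 4, 3, 2
   and 2, 1, 1. They sum to 13, so all are attained and nothing else exists. *)
have q : depth = 4 by nlia.
rewrite q in wa h1 h4 w13.
have a3 : wt a = 3 by nlia.
have aa2' : wt (a + a) = 2 by nlia.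
have b2 : wt b = 2 by nlia.
have d3' : size adec <= 3 by nlia.
have p2' : size aprim <= 2 by nlia.
have eD : \sum_(x <- adec) wt x = 4 by nlia.
have pE : size aprim = 2 by nlia.
have dE : size adec = 3 by nlia.
have [_ mP] := uniq_min_size ub sb p2'.
have [_ mD] := uniq_min_size us ss d3'.
have ab x : x \in aprim -> x = a \/ x = b.
  by rewrite -mP !inE => /orP[]/eqP; [left | right].
have inD x : x \in adec -> [\/ x = a + a, x = t | x = t'].
  by rewrite -mD !inE => /or3P[]/eqP;
    [constructor 1 | constructor 2 | constructor 3].
have nbaa := naa b bP.
have nbbt : b + b <> t by move=> ebt; move: npt; rewrite -ebt psumI.
have [z2 sub] : exists z2, {subset wdec2 <= [:: (a + a) + (a + a); z2]}.
  have eab : e = a \/ e = b := ab e eP.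
  (* The cases are [t' = a + b] and [t' = b + b]. *)
  exists (if e == a then a + a + b else b + b + b) => z zW.
  have zN := wdec_aperyN (wdec2_sub zW); have cz := wdec2_ge zW.
  have tc := apery_gt (adec_sub tD).
  have [y [u [yP uD ez]]] := wdec2_split zW.
  rewrite !inE; case: (inD u uD) => eu.
  - case: (ab y yP) => ey; first by nlia.
    have abD : b + a \in adec by apply: (tri _ _ a) => //;
      rewrite -ey -addnA -eu -ez.
    by case: eab => ee; case: (inD _ abD) => e1; try nlia;
       apply/orP; right; rewrite ee eqxx; apply/eqP; nlia.
  - case: (ab y yP) => ey; first by apply/orP; left; apply/eqP; nlia.
    have baaD : b + (a + a) \in adec.
      apply: (@aperyN_triple _ _ a) => //.
      by rewrite -addnA (addnC (a + a)) -et -eu -ey -ez.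
    by case: eab => ee; case: (inD _ baaD) => e1; nlia.
  - case: eab => ee; case: (ab y yP) => ey.
    + by apply/orP; right; rewrite ee eqxx; apply/eqP; nlia.
    + have bbD : b + b \in adec.
        by apply: (tri _ _ a) => //;
          rewrite -addnA -[in X in _ + X]ee -et' -eu -ey -ez.
      by case: (inD _ bbD) => e1; nlia.
    + have abD : a + b \in adec.
        by apply: (tri _ _ b) => //;
          rewrite -addnA -[X in _ + (_ + X)]ee -et' -eu -ey -ez.
      by case: (inD _ abD) => e1; nlia.
    + have -> : (e == a) = false by apply/eqP; nlia.
      by apply/orP; right; apply/eqP; nlia.
(* The budget holds as [12 + 8 <= 12 + 5 + 4], the last two terms being lower bounds for
   [rwt (a + a)] and [rwt t']. *)
apply: wilf_of_budget => //; rewrite dE pE eD q.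
have K2 : \sum_(z <- wdec2) cost z <= 4 + 4.
  apply: leq_trans (sum_wdec2 sub) _; rewrite !big_cons big_nil addn0 -q.
  by apply: leq_add; case w: (_ \in wdec2); rewrite ?mul1n // wdec2_le.
have R2 : rwt (a + a) + rwt t' <= \sum_(x <- adec2) rwt x.
  have <- : \sum_(x <- [:: a + a; t']) rwt x = rwt (a + a) + rwt t'.
    by rewrite !big_cons big_nil addn0.
  apply: leq_sum_sub => [|x]; last by rewrite !inE => /orP[]/eqP->.
  by rewrite /= inE andbT; apply/eqP => e1; apply: nt'a.
have := r2 _ t'2; rewrite q in raa *; nlia.
Qed.

Lemma wilf_left13 : c <= 13 * size prims.
Proof.
case D3 : adec3 => [|t s]; first exact: wilf_adec3_nil.
by apply: (@wilf_adec3 t); rewrite D3 inE eqxx.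
Qed.

End LeftPart.

(** * The theorem *)

Local Open Scope classical_set_scope.
Local Open Scope card_scope.

Lemma card_eq_size (A : set nat) (s : seq nat) (n : nat) : uniq s ->
  (forall x, A x <-> x \in s) -> A #= `I_n -> size s = n.
Proof.
move=> us As; have -> : A = [set` [fset x in s]%fset].
  by apply/seteqP; split=> x /=; rewrite inE => /As.
by move=> /card_eq_fsetP <-; rewrite card_fseq undup_id.
Qed.

Theorem theorem12p1 (S : set nat) (c e : nat)
  (hS : numerical_semigroup S) (hc : is_conductor S c) (he : has_embdim S e)
  (hL : (S `&` `I_c) #= `I_13) :
  c <= 13 * e.
Proof.
case: hS hc => S0 SD _ [Sc _].
(* The lists above need a Boolean predicate, obtained classically. *)
pose Sb : pred nat := fun x => `[< S x >].
have SbP x : reflect (S x) (Sb x) by apply: asboolP.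
have Sb0 : Sb 0 by apply/SbP.
have SbD a b : Sb a -> Sb b -> Sb (a + b).
  by move=> /SbP Sa /SbP Sb'; apply/SbP; apply: SD.
have Sbc x : c <= x -> Sb x by move=> cx; apply/SbP; rewrite -(subnKC cx).
have : exists k, (0 < k) && Sb k by exists c.+1; rewrite Sbc.
case/ex_minnP => m /andP[m_gt0 Sm] m_le.
have m_min x : 0 < x -> Sb x -> m <= x by move=> x0 Sx; rewrite m_le ?x0.
have size13 : size (left_part Sb c) = 13.
  apply: card_eq_size hL; first exact/filter_uniq/iota_uniq.
  move=> x; rewrite mem_filter mem_iota /=; split=> [[/SbP -> ->] //|].
  by move=> /andP[/SbP Sx xc]; split.
(* If [c <= m], then 0 alone could lie below [c], against the count 13. *)
have lt_mc : m < c.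
  rewrite ltnNge; apply/negP => le_cm; suff : size (left_part Sb c) <= 1.
    by rewrite size13.
  apply: (@uniq_leq_size _ _ [:: 0]); first exact/filter_uniq/iota_uniq.
  move=> x; rewrite mem_filter mem_iota inE => /andP[Sx /andP[_ xc]].
  rewrite eqn0Ngt; apply/negP => x0; have := m_min x x0 Sx.
  by rewrite leqNgt (leq_trans xc le_cm).
suff <- : size (prims Sb m c) = e by apply: wilf_left13.
apply: card_eq_size he; first exact/filter_uniq/iota_uniq.
move=> x; rewrite mem_filter mem_iota /=; split.
  case=> x0 /SbP Sx nx; have xcm : x < c + m.
    rewrite ltnNge; apply/negP => cmx; apply: nx; exists m, (x - m).
    have le_mx : m <= x by apply: leq_trans cmx; apply: leq_addl.
    have cxm : c <= x - m by rewrite leq_subRL // addnC.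
    split; rewrite ?subnKC //; [|exact/SbP|exact/SbP/Sbc].
    by apply: leq_trans cxm; apply: leq_ltn_trans lt_mc.
  rewrite Sx x0 xcm !andbT; apply/decP => -[a [b [a0 b0 /SbP Sa /SbP Sb' ex]]].
  by apply: nx; exists a, b.
move=> /andP[/and3P[/SbP Sx x0 /decP nx] _]; split=> // -[a [b [a0 b0 Sa Sb' ex]]].
by apply: nx; exists a, b; split=> //; apply/SbP.
Qed.
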